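(* There is a universal constant $c>0$ such that the following holds. Let $\varepsilon,\lambda\in(0,1)$ and let $G$ be a $k$-player game with $\mathrm{val}(G)\le 1-\varepsilon$. If the $(k-1)$-connection graph $H_G$ of $G$ is a $\lambda$-expander, then for all $n\ge \frac{\log(4/\varepsilon)}{\varepsilon^5\lambda^2}$, $$\mathrm{val}(G^{\otimes n})\le \exp\left(-\frac{c\,\varepsilon^5\lambda^2 n}{\log|\mathscr{A}|}\right),$$ where $\mathscr{A}=\mathscr{A}^1\times\cdots\times\mathscr{A}^k$ is the answer alphabet of $G$.
   Context: A $k$-player game $G=(\mu,V)$ consists of finite question sets $\mathscr{X}^1,\dots,\mathscr{X}^k$, finite answer sets $\mathscr{A}^1,\dots,\mathscr{A}^k$, a probability distribution $\mu$ on $\mathscr{X}=\mathscr{X}^1\times\cdots\times\mathscr{X}^k$, and a predicate $V:\mathscr{X}\times\mathscr{A}\to\{0,1\}$ with $\mathscr{A}=\mathscr{A}^1\times\cdots\times\mathscr{A}^k$. A referee samples $x=(x^1,\dots,x^k)\sim\mu$, sends $x^t$ to player $t$, who answers $a^t=f^t(x^t)$ (no communication); the players win if $V(x,a)=1$. The value $\mathrm{val}(G)$ is the maximum winning probability over all strategies $(f^1,\dots,f^k)$. The $n$-fold parallel repetition $G^{\otimes n}$ is the $k$-player game in which $n$ question tuples $x_1,\dots,x_n$ are drawn independently from $\mu$, player $t$ receives $(x^t_1,\dots,x^t_n)$ and answers $(a^t_1,\dots,a^t_n)$, and the players win iff $V(x_i,a_i)=1$ for every $i\in[n]$. Write $\mathsf{P}_X=\mu$,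 $x^{-t}$ for the questions of all players other than $t$, $\mathsf{P}_{X^{-t}}$ for the marginal of $x^{-t}$, and $\mathsf{P}_{X^t\mid x^{-t}}$ for the conditional distribution of player $t$'s question given $x^{-t}$. The $(k-1)$-connection graph $H_G$ is the weighted graph on vertex set $\mathscr{X}$ with weights $\rho(x,x)=\frac1k\mathsf{P}_X(x)\sum_{t\in[k]}\mathsf{P}_{X^t\mid x^{-t}}(x^t)$; $\rho(x,x')=\frac1k\mathsf{P}_{X^{-t}}(x^{-t})\mathsf{P}_{X^t\mid x^{-t}}(x^t)\mathsf{P}_{X^t\mid x^{-t}}(x'^t)$ if there is $t$ with $x^{-t}=x'^{-t}$ and $x^t\neq x'^t$; and $\rho(x,x')=0$ otherwise. (Equivalently $\rho(x,x')$ is the probability of: sample $x\sim\mu$, pick $t\in[k]$ uniformly, sample $x'\sim\mu$ conditioned on $x'^{-t}=x^{-t}$.) Then $\rho(x):=\sum_{x'}\rho(x,x')=\mathsf{P}_X(x)$. Graph properties of $H_G$ are taken only over vertices with $\rho(x)>0$. The normalized Laplacian $L$ of $H_G$ is the matrix indexed by such vertices with $L_{u,u}=1-\rho(u,u)/\rho(u)$ and $L_{u,v}=-\rho(u,v)/\sqrt{\rho(u)\rho(v)}$ for $u\ne v$; $\lambda(H_G)$ denotes its second smallest eigenvalue, and $H_G$ is a $\lambda$-expander if $\lambda(H_G)\ge\lambda$. *)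

(* Defs.v *)
From HB Require Import structures.
From mathcomp Require Import all_boot all_order all_algebra.
From mathcomp Require Import reals exp.
Set Implicit Arguments. Unset Strict Implicit. Unset Printing Implicit Defensive.
Import Order.TTheory GRing.Theory Num.Theory.
Local Open Scope ring_scope.

Section Games.
Variable R : realType.
Variable k : nat.

Definition qtuple (Q : 'I_k -> finType) := {dffun forall t : 'I_k, Q t}.

Record game (Q A : 'I_k -> finType) := Game {
  gmu : {ffun qtuple Q -> R};
  gV : qtuple Q -> qtuple A -> bool }.

Definition is_distr (T : finType) (mu : {ffun T -> R}) :=
  (forall x, 0 <= mu x) /\ \sum_x mu x = 1.

Definition strategy (Q A : 'I_k -> finType) :=
  {dffun forall t : 'I_k, {ffun Q t -> A t}}.

Definition answers (Q A : 'I_k -> finType) (f : strategy Q A) (x : qtuple Q)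
  : qtuple A := finfun (fun t : 'I_k => f t (x t)).

Definition win_prob (Q A : 'I_k -> finType) (G : game Q A) (f : strategy Q A) : R :=
  \sum_(x : qtuple Q) gmu G x * (gV G x (answers f x))%:R.

Definition game_val (Q A : 'I_k -> finType) (G : game Q A) : R :=
  \big[Num.max/0]_(f : strategy Q A) win_prob G f.

Definition rep_fam (n : nat) (Q : 'I_k -> finType) : 'I_k -> finType :=
  fun t => {ffun 'I_n -> Q t}.

Definition coord (n : nat) (Q : 'I_k -> finType) (x : qtuple (rep_fam n Q))
  (i : 'I_n) : qtuple Q := finfun (fun t : 'I_k => x t i).

Definition rep_game (Q A : 'I_k -> finType) (G : game Q A) (n : nat)
  : game (rep_fam n Q) (rep_fam n A) :=
  Game [ffun x : qtuple (rep_fam n Q) => \prod_(i < n) gmu G (coord x i)]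
       (fun x a => [forall i : 'I_n, gV G (coord x i) (coord a i)]).

Section Connection.
Variables (Q : 'I_k -> finType) (mu : {ffun qtuple Q -> R}).

Definition agree_except (t : 'I_k) (x y : qtuple Q) : bool :=
  [forall s : 'I_k, (s != t) ==> (x s == y s)].

Definition marg (t : 'I_k) (x : qtuple Q) : R :=
  \sum_(y | agree_except t x y) mu y.

(* P_{X^t | x^{-t}}(y^t) for y with y^{-t} = x^{-t} *)
Definition cond (t : 'I_k) (y : qtuple Q) : R := mu y / marg t y.

Definition rho (x x' : qtuple Q) : R :=
  if x == x' then k%:R^-1 * mu x * \sum_(t < k) cond t x
  else k%:R^-1 * \sum_(t < k)
         (agree_except t x x')%:R * (marg t x * cond t x * cond t x').

Definition rho1 (x : qtuple Q) : R := \sum_x' rho x x'.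

Definition support : {set qtuple Q} := [set x | 0 < rho1 x].

Definition vtx (i : 'I_#|support|) : qtuple Q := enum_val i.

Definition laplacian : 'M[R]_#|support| :=
  \matrix_(i, j)
    if i == j then 1 - rho (vtx i) (vtx i) / rho1 (vtx i)
    else - rho (vtx i) (vtx j) / Num.sqrt (rho1 (vtx i) * rho1 (vtx j)).

Definition second_smallest_eig (l : R) : Prop :=
  exists s : seq R, [/\ sorted <=%R s,
    char_poly laplacian = \prod_(a <- s) ('X - a%:P) & nth 0 s 1 = l].

Definition is_expander (lam : R) : Prop :=
  exists l, second_smallest_eig l /\ lam <= l.

End Connection.
End Games.

(* Main.v *)
Require Import Defs.
From HB Require Import structures.
From mathcomp Require Import all_boot all_order all_algebra.
From mathcomp Require Import spectral sesquilinear complex.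
From mathcomp Require Import reals sequences exp Rstruct.
From mathcomp Require Import ring lra.
Set Implicit Arguments. Unset Strict Implicit. Unset Printing Implicit Defensive.
Import Order.TTheory GRing.Theory Num.Theory.
Local Open Scope ring_scope.

(** Fix strategies for the repeated game and a set [C] of coordinates that are
    won with probability [p].  For a coordinate [j] outside [C] reveal a random
    player [t_j] together with the questions of all other players; for [j] in
    [C] reveal the whole question, and also the answers [a] on [C].  Given the
    revealed data [r], the remaining questions are independent over coordinates
    and belong to one player each, so the event [replies = a] is a product event
    over the players.  Let [g_i x] be its conditional probability given [r] and
    the question [x] at coordinate [i].

    Superadditivity of entropy bounds the sum over [i] of the variances of
    [sqrt g_i] along the edges of the connection graph by the entropy of the
    event; the spectral gap is a Poincare inequality, which turns this into a
    bound on the variance of [sqrt g_i] under [mu].  Hence [r] is nearly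
    independent of the question at [i], and the players can sample it with
    shared randomness and play one copy of the game: the conditional probability
    of winning [i] is at most [1 - eps / 2] plus twice that variance.  Averaging
    over [i] yields a coordinate whose addition to [C] multiplies [p] by at most
    [1 - eps / 4], as long as [#|C| * ln #|A| + ln (1 / p)] is small compared to
    [n * eps * lam]. *)

(** * Product measures *)

Section ProductExpectation.
Variables (R : realType) (I X : finType).
Implicit Types (nu : I -> X -> R) (y : {ffun I -> X}) (H g : {ffun I -> X} -> R).

Definition upd y (i : I) (x : X) : {ffun I -> X} :=
  [ffun j => if j == i then x else y j].

Lemma upd_same y i x : upd y i x i = x.
Proof. by rewrite ffunE eqxx. Qed.

Lemma upd_other y i x j : j != i -> upd y i x j = y j.
Proof. by rewrite ffunE => /negPf->. Qed.

Lemma upd_upd y i x x' : upd (upd y i x) i x' = upd y i x'.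
Proof. by apply/ffunP => j; rewrite !ffunE; case: eqP. Qed.

Lemma upd_id y i : upd y i (y i) = y.
Proof. by apply/ffunP => j; rewrite !ffunE; case: eqP => [->|]. Qed.

Definition expect nu H : R := \sum_(y : {ffun I -> X}) (\prod_j nu j (y j)) * H y.

Lemma eq_expect nu H H' : H =1 H' -> expect nu H = expect nu H'.
Proof. by move=> eH; apply: eq_bigr => y _; rewrite eH. Qed.

Lemma expect_ge0 nu H : (forall j x, 0 <= nu j x) -> (forall y, 0 <= H y) ->
  0 <= expect nu H.
Proof.
by move=> nu0 H0; apply: sumr_ge0 => y _; rewrite mulr_ge0 // prodr_ge0.
Qed.

Lemma ler_expect nu H H' : (forall j x, 0 <= nu j x) ->
  (forall y, H y <= H' y) -> expect nu H <= expect nu H'.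
Proof.
by move=> nu0 HH; apply: ler_sum => y _; rewrite ler_wpM2l // prodr_ge0.
Qed.

Lemma expect_sum nu (J : finType) (P : pred J) (F : J -> {ffun I -> X} -> R) :
  expect nu (fun y => \sum_(a | P a) F a y) = \sum_(a | P a) expect nu (F a).
Proof.
rewrite exchange_big /=; apply: eq_bigr => y _.
by rewrite mulr_sumr.
Qed.

Lemma expectZ nu c H : expect nu (fun y => c * H y) = c * expect nu H.
Proof. by rewrite mulr_sumr; apply: eq_bigr => y _; rewrite mulrCA. Qed.

Lemma expectD nu H H' :
  expect nu (fun y => H y + H' y) = expect nu H + expect nu H'.
Proof. by rewrite -big_split; apply: eq_bigr => y _; rewrite mulrDr. Qed.

Lemma expect_prod nu (h : I -> X -> R) :
  expect nu (fun y => \prod_j h j (y j)) = \prod_j \sum_x nu j x * h j x.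
Proof.
rewrite bigA_distr_bigA; apply: eq_bigr => y _.
by rewrite -big_split.
Qed.

Lemma expect1 nu : (forall j, \sum_x nu j x = 1) -> expect nu (fun=> 1) = 1.
Proof.
move=> nu1; have := expect_prod nu (fun _ _ => 1).
under eq_expect do rewrite big1 //.
by move=> ->; rewrite big1 // => j _; under eq_bigr do rewrite mulr1.
Qed.

(* The map [(y, x) |-> (upd y i x, y i)] is an involution that exchanges the
   factor at [i] of the product weight with the fresh weight of [x]. *)
Lemma expect_resample nu nu' i H :
  (forall j, j != i -> nu j =1 nu' j) -> \sum_x nu i x = 1 ->
  expect nu' H = expect nu (fun y => \sum_x nu' i x * H (upd y i x)).
Proof.
move=> enu nu1; rewrite /expect.
under [RHS]eq_bigr do rewrite mulr_sumr.
rewrite pair_bigA /=.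
pose sw (p : {ffun I -> X} * X) := (upd p.1 i p.2, p.1 i).
have swK : involutive sw.
  by case=> y x; rewrite /sw /= upd_upd upd_id upd_same.
rewrite (reindex_inj (inv_inj swK)) /=.
(* The factor [nu i p.2] sums to 1, so it comes for free; the swap makes it the weight at [i]. *)
transitivity (\sum_(p : {ffun I -> X} * X)
    ((\prod_j nu' j (p.1 j)) * H p.1) * nu i p.2).
  rewrite -(pair_bigA _ (fun y x => (\prod_j nu' j (y j)) * H y * nu i x)) /=.
  by apply: eq_bigr => y _; rewrite -mulr_sumr nu1 mulr1.
apply: eq_bigr => -[y x] _ /=; rewrite upd_upd upd_id.
rewrite (bigD1 i) //= [in RHS](bigD1 i) //= upd_same.
have -> : \prod_(j | j != i) nu j (upd y i x j) = \prod_(j | j != i) nu' j (y j).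
  by apply: eq_bigr => j ji; rewrite upd_other // enu.
by ring.
Qed.

Lemma expect_indep nu nu' i H :
  (forall j, j != i -> nu j =1 nu' j) ->
  \sum_x nu i x = 1 -> \sum_x nu' i x = 1 ->
  (forall y x, H (upd y i x) = H y) -> expect nu H = expect nu' H.
Proof.
move=> enu nu1 nu1' Hi; rewrite [RHS](expect_resample _ enu nu1).
apply: eq_expect => y; under eq_bigr do rewrite Hi.
by rewrite -mulr_suml nu1' mul1r.
Qed.

Lemma expect_marginal nu i (h : X -> R) g : \sum_x nu i x = 1 ->
  expect nu (fun y => h (y i) * g y) =
  \sum_x nu i x * (h x * expect nu (fun y => g (upd y i x))).
Proof.
move=> nu1; rewrite (expect_resample (nu := nu) _ _ nu1) //.
rewrite expect_sum; apply: eq_bigr => x _.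
rewrite expectZ; congr (_ * _); rewrite -expectZ.
by apply: eq_expect => y; rewrite upd_same.
Qed.

End ProductExpectation.

(** Distributivity: mixing each coordinate separately is mixing the product measure over independent
    labels [r]. Transcripts of the repeated game enter this way. *)
Lemma expect_mix (R : realType) (I X S : finType) (pi : S -> R)
    (nu : I -> S -> X -> R) (mu : X -> R) (H : {ffun I -> X} -> R) :
  (forall j x, \sum_s pi s * nu j s x = mu x) ->
  expect (fun=> mu) H =
  expect (fun=> pi) (fun r : {ffun I -> S} => expect (fun j => nu j (r j)) H).
Proof.
move=> mix; rewrite /expect.
under [RHS]eq_bigr do rewrite mulr_sumr.
rewrite exchange_big /=; apply: eq_bigr => y _.
under [RHS]eq_bigr do rewrite mulrA -big_split /=.
rewrite -mulr_suml; congr (_ * _).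
rewrite -(bigA_distr_bigA (fun j s => pi s * nu j s (y j))).
by apply: eq_bigr => j _; rewrite mix.
Qed.

(** * Entropy and variance of square roots *)

Section Entropy.
Variable R : realType.

Lemma ln_le_subr1 (x : R) : 0 < x -> ln x <= x - 1.
Proof.
move=> x0; have -> : x = 1 + (x - 1) by ring.
apply: le_trans (le_ln1Dx _) _; lra.
Qed.

(** The concave function [- x ln x] lies below its tangent at [b]; later this takes the place of
    Jensen's inequality. *)
Lemma xlnx_tangent (a b : R) : 0 <= a -> 0 < b ->
  - (a * ln a) <= - (a * ln b) + b - a.
Proof.
rewrite le_eqVlt => /orP[/eqP<-|a0] b0; first by rewrite !mul0r; lra.
have := ln_le_subr1 (divr_gt0 b0 a0); rewrite ln_div ?posrE // => h.
have := ler_wpM2l (ltW a0) h; rewrite mulrBr mulrBr mulr1.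
rewrite mulrCA divff ?gt_eqF // mulr1; lra.
Qed.

Lemma ln_prod (J : finType) (P : pred J) (F : J -> R) : (forall j, 0 < F j) ->
  ln (\prod_(j | P j) F j) = \sum_(j | P j) ln (F j).
Proof.
move=> F0.
rewrite -[RHS]expRK expR_sum; congr ln; apply: eq_bigr => j _.
by rewrite lnK ?posrE.
Qed.

(** For [a > 0] this is [ln t <= t - 1] at [t = sqrt (b / a)], multiplied by [2 a]. *)
Lemma hellinger_le_entropy (a b : R) : 0 <= a -> 0 < b ->
  2 * (a - Num.sqrt b * Num.sqrt a) <= a * ln (a / b).
Proof.
rewrite le_eqVlt => /orP[/eqP<-|a0] b0; first by rewrite sqrtr0 !mul0r; lra.
have sa : 0 < Num.sqrt a by rewrite sqrtr_gt0.
have sb : 0 < Num.sqrt b by rewrite sqrtr_gt0.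
have ea := sqr_sqrtr (ltW a0); have eb := sqr_sqrtr (ltW b0).
move: (Num.sqrt a) (Num.sqrt b) sa sb ea eb => u v u0 v0 <- <-.
rewrite -expr_div_n lnXn ?divr_gt0 //.
have := ln_le_subr1 (divr_gt0 v0 u0); rewrite !ln_div ?posrE // => h.
have := ler_wpM2l (ltW (exprn_gt0 2 u0)) h.
have -> : u ^+ 2 * (v / u - 1) = v * u - u ^+ 2.
  by field; rewrite gt_eqF.
rewrite mulr2n; lra.
Qed.

End Entropy.

(** * Superadditivity of entropy on a product space *)

Section ProductEntropy.
Variables (R : realType) (I X : finType) (nu : I -> X -> R).
Hypothesis nu0 : forall j x, 0 <= nu j x.
Hypothesis nu1 : forall j, \sum_x nu j x = 1.
Variable g : {ffun I -> X} -> R.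
Hypothesis g01 : forall y, 0 <= g y <= 1.
Variable P : pred I.

(** The conditional mean of [g] given that coordinate [i] equals [x]. *)
Let G i x := expect nu (fun y => g (upd y i x)).
Let alpha := expect nu g.

Lemma cond_mean_ge0 i x : 0 <= G i x.
Proof. by apply: expect_ge0 => // y; case/andP: (g01 (upd y i x)). Qed.

Lemma cond_mean_average i : \sum_x nu i x * G i x = alpha.
Proof.
have := @expect_marginal R I X nu i (fun=> 1) g (nu1 i).
under eq_expect do rewrite mul1r.
by rewrite /alpha => ->; apply: eq_bigr => x _; rewrite mul1r.
Qed.

(** The point [y] itself contributes to this mean. Arguments of [ln] are thereby positive wherever
    [g] has weight. *)
Lemma cond_mean_gt0 i (y : {ffun I -> X}) : 0 < (\prod_j nu j (y j)) * g y -> 0 < G i (y i).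
Proof.
move=> h; apply: lt_le_trans h _.
rewrite /G /expect (bigD1 y) //= upd_id lerDl; apply: sumr_ge0 => y' _.
by rewrite mulr_ge0 ?prodr_ge0 //; case/andP: (g01 (upd y' i (y i))).
Qed.

Lemma expect_g_ge0 : 0 <= alpha.
Proof. by apply: expect_ge0 => // y; case/andP: (g01 y). Qed.

(** The ratios [G i / alpha] depend on independent coordinates and have mean 1 each, or are 0 if
    [alpha] is 0. *)
Lemma expect_prod_cond_mean : expect nu (fun y => \prod_(i | P i) (G i (y i) / alpha)) <= 1.
Proof.
have -> : expect nu (fun y => \prod_(i | P i) (G i (y i) / alpha)) =
    expect nu (fun y => \prod_i (if P i then G i (y i) / alpha else 1)).
  by apply: eq_expect => y; rewrite -big_mkcond.
rewrite (expect_prod nu (fun i x => if P i then G i x / alpha else 1)).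
apply: prodr_ile1 => i; case: (P i); last first.
  by under eq_bigr do rewrite mulr1; rewrite nu1 ler01 lexx.
under eq_bigr do rewrite mulrA; rewrite -mulr_suml cond_mean_average.
have [->|a0] := eqVneq alpha 0; first by rewrite mul0r ler01 lexx.
by rewrite divff // ler01 lexx.
Qed.

Lemma var_le_entropy i : 0 < alpha ->
  alpha - (\sum_x nu i x * Num.sqrt (G i x)) ^+ 2 <=
  \sum_x nu i x * (G i x * ln (G i x / alpha)).
Proof.
move=> a0; set h := \sum_x _.
(* The two sides differ by [(sqrt alpha - h) ^ 2]. *)
apply: le_trans (_ : 2 * (alpha - Num.sqrt alpha * h) <= _).
  rewrite -{1 2}(sqr_sqrtr (ltW a0)).
  have := sqr_ge0 (Num.sqrt alpha - h); rewrite sqrrB mulr2n; lra.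
rewrite -{1}(cond_mean_average i) mulr_sumr -sumrB mulr_sumr; apply: ler_sum => x _.
have := ler_wpM2l (nu0 i x) (hellinger_le_entropy (cond_mean_ge0 i x) a0); lra.
Qed.

(* Superadditivity of entropy over the independent coordinates, combined with
   [ent(g) <= - alpha ln alpha] for [g] with values in [[0, 1]]. *)
Lemma sum_var_sqrt_le :
  \sum_(i | P i) (alpha - (\sum_x nu i x * Num.sqrt (G i x)) ^+ 2) <=
  - (alpha * ln alpha).
Proof.
have [a0|a0] := leP alpha 0.
  have -> : alpha = 0 by apply/eqP; rewrite eq_le a0 expect_g_ge0.
  rewrite mul0r oppr0; apply: sumr_le0 => i _.
  by rewrite sub0r oppr_le0 sqr_ge0.
apply: le_trans (ler_sum _ (fun i _ => var_le_entropy i a0)) _.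
rewrite (eq_bigr (fun i => expect nu (fun y => ln (G i (y i) / alpha) * g y))); last first.
  move=> i _; rewrite (@expect_marginal R I X nu i (fun x => ln (G i x / alpha))) //.
  by apply: eq_bigr => x _; rewrite [G i x * _]mulrC.
rewrite -expect_sum.
pose W y := \prod_(i | P i) (G i (y i) / alpha).
(* Pointwise this is [ln (alpha * W y) <= alpha * W y - 1] times [g y], with [g y <= 1] used on the
   term [alpha * W y]. In expectation that term is at most [alpha] and cancels. *)
apply: le_trans (_ : expect nu (fun y => - ln alpha * g y + alpha * W y - g y) <= _).
  apply: ler_sum => y _; rewrite -mulr_suml.
  have [gy0 gy1] := andP (g01 y).
  have w0 : 0 <= \prod_j nu j (y j) by rewrite prodr_ge0.
  have W0 : 0 <= W y by rewrite prodr_ge0 // => i _; rewrite divr_ge0 ?cond_mean_ge0 ?ltW.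
  (* Points of zero weight are set apart: there [W y] may be 0, out of reach of the logarithm
     bound. *)
  have [wg0|wg0] := leP ((\prod_j nu j (y j)) * g y) 0.
    have {}wg0 : (\prod_j nu j (y j)) * g y = 0.
      by apply/eqP; rewrite eq_le wg0 mulr_ge0.
    rewrite [_ * g y]mulrC mulrA wg0 mul0r.
    have -> : (\prod_j nu j (y j)) * (- ln alpha * g y + alpha * W y - g y) =
      (\prod_j nu j (y j)) * g y * (- ln alpha - 1) +
      (\prod_j nu j (y j)) * (alpha * W y) by ring.
    by rewrite wg0 mul0r add0r !mulr_ge0 // ltW.
  apply: ler_wpM2l => //.
  have Wi0 i : 0 < G i (y i) / alpha by rewrite divr_gt0 ?cond_mean_gt0.
  have -> : \sum_(i | P i) ln (G i (y i) / alpha) = ln (W y).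
    by rewrite ln_prod.
  have W1 : 0 < W y by rewrite prodr_gt0.
  have := ln_le_subr1 (mulr_gt0 a0 W1); rewrite lnM ?posrE // => hl.
  have := ler_wpM2l gy0 hl.
  have : g y * (alpha * W y) <= alpha * W y by rewrite ler_piMl // mulr_ge0 // ltW.
  lra.
rewrite (expectD nu (fun y => _ + _) (fun y => - g y)) expectD !expectZ.
have -> : expect nu (fun y => - g y) = - alpha.
  by rewrite -[RHS]mulN1r -expectZ; apply: eq_expect => y; rewrite mulN1r.
rewrite -/alpha; have := ler_wpM2l (ltW a0) expect_prod_cond_mean; rewrite mulr1 /W; lra.
Qed.

End ProductEntropy.

(** * Randomized strategies for one game *)

Lemma sum_dffun_prod (R : comNzRingType) (I : finType) (T : I -> finType)
    (F : forall t, T t -> R) :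
  \sum_(y : {dffun forall t, T t}) \prod_t F t (y t) = \prod_t \sum_q F t q.
Proof.
pose P t : {ffun T t -> R} := [ffun q => F t q].
rewrite (reindex (@dffun_of_fprod _ T)) /=; last exact/onW_bij/dffun_of_fprod_bij.
transitivity (\sum_(y : fprod T) \prod_(t in I) P t (y t)).
  by apply: eq_bigr => y _; apply: eq_bigr => t _; rewrite !ffunE.
rewrite big_fprod.
under [RHS]eq_bigr => t _.
  rewrite (eq_bigr (fun q => P t q)); last by move=> q _; rewrite ffunE.
  rewrite (big_tag (fun t => P t) t); over.
by rewrite bigA_distr_big_dep.
Qed.

Lemma natr_forall (R : comNzRingType) (J : finType) (B : pred J) :
  [forall j, B j]%:R = \prod_j (B j)%:R :> R.
Proof.
have [/forallP h|/forallPn[j /negPf hj]] := boolP [forall j, B j].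
  by rewrite big1 // => j _; rewrite h.
by rewrite (bigD1 j) //= hj mul0r.
Qed.

Lemma dffun_eqE (I : finType) (T : I -> finType) (a b : {dffun forall t, T t}) :
  (a == b) = [forall t, a t == b t].
Proof.
apply/eqP/forallP => [-> //|h]; apply/ffunP => t; exact/eqP.
Qed.

(** For a probability [nu] and [g >= 0] this is the variance of [sqrt g], as [g] is the square of
    [sqrt g]. *)
Definition var_sqrt (R : realType) (X : finType) (nu g : X -> R) : R :=
  \sum_x nu x * g x - (\sum_x nu x * Num.sqrt (g x)) ^+ 2.

Section OneShot.
Variables (R : realType) (k : nat) (Q A : 'I_k -> finType) (G : game R Q A).
Hypothesis muD : is_distr (gmu G).

Let mu0 : forall x, 0 <= gmu G x. Proof. by case: muD. Qed.
Let mu1 : \sum_x gmu G x = 1. Proof. by case: muD. Qed.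

Lemma win_prob_le_val f : win_prob G f <= game_val G.
Proof. exact: le_bigmax. Qed.

(** Drawing all answers in advance, independently for each player and question, turns [q] into a
    mixture [P] of deterministic strategies, none of which beats the value. *)
Lemma randomized_le_val (q : forall t, Q t -> A t -> R) :
  (forall t x b, 0 <= q t x b) -> (forall t x, \sum_b q t x b = 1) ->
  \sum_x gmu G x * (\sum_(b : qtuple A) (gV G x b)%:R * \prod_t q t (x t) (b t)) <= game_val G.
Proof.
move=> q0 q1; pose W t (phi : {ffun Q t -> A t}) := \prod_x q t x (phi x).
pose P (f : strategy Q A) := \prod_t W t (f t).
have W1 t : \sum_phi W t phi = 1.
  by rewrite -(bigA_distr_bigA (q t)) big1.
have P1 : \sum_f P f = 1 by rewrite sum_dffun_prod big1.
have PE x b : \sum_f P f * (answers f x == b)%:R = \prod_t q t (x t) (b t).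
  transitivity (\sum_(f : strategy Q A) \prod_t (W t (f t) * (f t (x t) == b t)%:R)).
    apply: eq_bigr => f _; rewrite big_split dffun_eqE natr_forall; congr (_ * _).
    by apply: eq_bigr => t _; rewrite ffunE.
  rewrite (sum_dffun_prod (fun t phi => W t phi * (phi (x t) == b t)%:R)).
  apply: eq_bigr => t _.
  transitivity (\sum_(phi : {ffun Q t -> A t}) \prod_z
      (q t z (phi z) * (if z == x t then (phi z == b t)%:R else 1))).
    apply: eq_bigr => phi _; rewrite big_split; congr (_ * _).
    by rewrite -big_mkcond big_pred1_eq.
  rewrite -(bigA_distr_bigA (fun z a => q t z a * (if z == x t then (a == b t)%:R else 1))).
  rewrite (bigD1 (x t)) //= [X in _ * X]big1 => [|z /negPf->]; last first.
    by under eq_bigr do rewrite mulr1; rewrite q1.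
  rewrite mulr1 eqxx (bigD1 (b t)) //= eqxx mulr1 big1 ?addr0 // => a /negPf->.
  by rewrite mulr0.
have -> : \sum_x gmu G x * (\sum_(b : qtuple A) (gV G x b)%:R * \prod_t q t (x t) (b t)) =
    \sum_f P f * win_prob G f.
  under [RHS]eq_bigr do rewrite mulr_sumr.
  rewrite exchange_big /=; apply: eq_bigr => x _.
  under [RHS]eq_bigr do rewrite mulrCA.
  rewrite -mulr_sumr; congr (_ * _).
  under eq_bigr do rewrite -PE mulr_sumr.
  rewrite exchange_big /=; apply: eq_bigr => f _.
  rewrite (bigD1 (answers f x)) //= eqxx mulr1 mulrC big1 ?addr0 // => b.
  by rewrite eq_sym => /negPf->; rewrite !mulr0.
rewrite -[leRHS]mul1r -P1 mulr_suml; apply: ler_sum => f _.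
by rewrite ler_wpM2l ?win_prob_le_val // !prodr_ge0 // => t _; rewrite prodr_ge0.
Qed.

(* Answering according to the normalised [Psi] wins with probability at most
   [game_val G]; reweighting the questions by [g] instead of a constant costs
   at most the [gmu G]-variance of [sqrt g]. *)
Lemma one_shot (Psi : forall t, Q t -> A t -> R) (d : forall t, Q t -> A t)
    (g : qtuple Q -> R) eps :
  (forall t x b, 0 <= Psi t x b) -> 0 <= eps -> game_val G <= 1 - eps ->
  (forall x, g x = \sum_(b : qtuple A) \prod_t Psi t (x t) (b t)) ->
  \sum_x gmu G x * (\sum_(b : qtuple A) (gV G x b)%:R * \prod_t Psi t (x t) (b t)) <=
  (1 - eps / 2) * (\sum_x gmu G x * g x) + 2 * var_sqrt (gmu G) g.
Proof.
move=> Psi0 eps0 valG gdef; set v := var_sqrt _ _.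
pose S t x := \sum_b Psi t x b.
(* Where the mass [S t x] vanishes, the default answer [d t x] keeps [q t x] a probability
   distribution. *)
pose q t x b := if S t x == 0 then (b == d t x)%:R else Psi t x b / S t x.
have S0 t x : 0 <= S t x by rewrite sumr_ge0.
have q0 t x b : 0 <= q t x b.
  by rewrite /q; case: ifP => _; rewrite ?ler0n ?divr_ge0.
have q1 t x : \sum_b q t x b = 1.
  rewrite /q; have [_|Sn0] := eqVneq (S t x) 0; last by rewrite -mulr_suml divff.
  by rewrite (bigD1 (d t x)) //= eqxx big1 ?addr0 // => b /negPf->.
have PsiE t x b : Psi t x b = S t x * q t x b.
  rewrite /q; case: ifPn => [/eqP Se|Sn0]; last by rewrite mulrC divfK.
  rewrite Se mul0r; apply/eqP.
  move/eqP: Se; rewrite /S psumr_eq0 => [|b' _]; last exact: Psi0.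
  by move/allP/(_ b); rewrite mem_index_enum => /(_ isT).
pose u x := 1 - \sum_(b : qtuple A) (gV G x b)%:R * \prod_t q t (x t) (b t).
have gE x : g x = \prod_t S t (x t) by rewrite gdef (sum_dffun_prod (fun t b => Psi t (x t) b)).
have g0 x : 0 <= g x by rewrite gE prodr_ge0.
have wE x : \sum_(b : qtuple A) (gV G x b)%:R * \prod_t Psi t (x t) (b t) = g x * (1 - u x).
  rewrite /u opprB addrC subrK mulr_sumr; apply: eq_bigr => b _.
  rewrite mulrCA gE -big_split; congr (_ * _).
  by apply: eq_bigr => t _; rewrite PsiE.
have u01 x : 0 <= u x <= 1.
  rewrite /u subr_ge0 lerBlDr lerDl; apply/andP; split; last first.
    by apply: sumr_ge0 => b _; rewrite mulr_ge0 ?prodr_ge0.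
  apply: le_trans (_ : \sum_(b : qtuple A) \prod_t q t (x t) (b t) <= _).
    apply: ler_sum => b _; rewrite ler_piMl ?prodr_ge0 //.
    by case: (gV G x b); rewrite ?ler01.
  by rewrite (sum_dffun_prod (fun t b => q t (x t) b)) big1.
have ueps : eps <= \sum_x gmu G x * u x.
  have := le_trans (randomized_le_val q0 q1) valG.
  have -> : \sum_x gmu G x * u x = 1 -
      \sum_x gmu G x * (\sum_(b : qtuple A) (gV G x b)%:R * \prod_t q t (x t) (b t)).
    rewrite -[X in X - _]mu1 -sumrB; apply: eq_bigr => x _; by rewrite /u mulrBr mulr1.
  lra.
under eq_bigr do rewrite wE.
pose h := \sum_x gmu G x * Num.sqrt (g x).
set beta := \sum_x gmu G x * g x.
have vdef : v = beta - h ^+ 2 by [].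
have vE : v = \sum_x gmu G x * (Num.sqrt (g x) - h) ^+ 2.
  transitivity (\sum_x (gmu G x * g x - 2 * h * (gmu G x * Num.sqrt (g x)) +
      h ^+ 2 * gmu G x)); last first.
    apply: eq_bigr => x _; rewrite sqrrB sqr_sqrtr // mulr2n; ring.
  rewrite big_split sumrB /= -!mulr_sumr mu1 -/h -/beta vdef; ring.
have beta0 : 0 <= beta by apply: sumr_ge0 => x _; rewrite mulr_ge0.
(* With [s = sqrt (g x)], [s ^ 2 >= h ^ 2 / 2 - (s - h) ^ 2]: replacing [g] by the constant
   [h ^ 2 / 2] in the losing mass costs at most the variance [v]. *)
have key : h ^+ 2 / 2 * eps - v <= \sum_x gmu G x * (g x * u x).
  apply: le_trans (_ : \sum_x (h ^+ 2 / 2 * (gmu G x * u x) -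
      gmu G x * (Num.sqrt (g x) - h) ^+ 2) <= _).
    rewrite sumrB -vE -mulr_sumr lerD2r ler_wpM2l ?divr_ge0 ?sqr_ge0 //.
  apply: ler_sum => x _.
  rewrite mulrCA -mulrBr ler_wpM2l //.
  have [ux0 ux1] := andP (u01 x).
  rewrite -{2}(sqr_sqrtr (g0 x)); move: (Num.sqrt (g x)) (u x) ux0 ux1 => s z z0 z1.
  have e1 : z * (s - h) ^+ 2 <= (s - h) ^+ 2 by rewrite ler_piMl ?sqr_ge0.
  have e2 : 0 <= z * (2 * s - h) ^+ 2 by rewrite mulr_ge0 ?sqr_ge0.
  have e3 : s ^+ 2 * z = h ^+ 2 / 2 * z - z * (s - h) ^+ 2 + z * (2 * s - h) ^+ 2 / 2.
    by field.
  rewrite e3; lra.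
have -> : \sum_x gmu G x * (g x * (1 - u x)) =
    beta - \sum_x gmu G x * (g x * u x).
  by rewrite -sumrB; apply: eq_bigr => x _; rewrite mulrBr mulr1 mulrBr.
have hE : h ^+ 2 = beta - v by rewrite vdef; ring.
have v0 : 0 <= v by rewrite vE sumr_ge0 // => x _; rewrite mulr_ge0 ?sqr_ge0.
have eps1 : eps <= 1.
  have : 0 <= game_val G by apply: bigmax_ge_id.
  lra.
(* The variance has acquired the factor [1 + eps / 2], which is at most 2. *)
have := ler_wpM2r v0 eps1.
move: key; rewrite hE; nra.
Qed.

End OneShot.

(** * Spectral gap of symmetric matrices *)

Section SpectralGap.
Local Open Scope sesquilinear_scope.

Lemma char_poly_conj (C : fieldType) N (P D : 'M[C]_N) : P \in unitmx ->
  char_poly (invmx P *m D *m P) = char_poly D.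
Proof.
move=> Pu; pose p := map_mx (polyC : C -> {poly C}) P.
pose p' := map_mx (polyC : C -> {poly C}) (invmx P).
have pp' : p' *m p = 1%:M by rewrite -map_mxM mulVmx // map_scalar_mx.
have -> : char_poly (invmx P *m D *m P) = \det (p' *m char_poly_mx D *m p).
  rewrite /char_poly /char_poly_mx !map_mxM mulmxBr mulmxBl.
  by rewrite -scalemx1 -scalemxAr mulmx1 -scalemxAl pp'.
by rewrite !det_mulmx mulrAC -det_mulmx pp' det1 mul1r.
Qed.

(** In a unitary eigenbasis at most one eigenvalue fails to be at least [a]. The null vector [u] is
    supported on its coordinate, so [v], orthogonal to [u], has no component there. *)
Lemma normalmx_gap (C : numClosedFieldType) N (A : 'M[C]_N) (s : seq C) (a : C)
    (u v : 'rV[C]_N) :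
  A \is normalmx -> char_poly A = \prod_(x <- s) ('X - x%:P) -> 0 < a ->
  (count (fun x => ~~ (a <= x)%R) s <= 1)%N ->
  u *m A = 0 -> u != 0 -> v *m u^t* = 0 ->
  a * (v *m v^t*) 0 0 <= (v *m A *m v^t*) 0 0.
Proof.
move=> /orthomx_spectralP; set P := spectralmx A; set d := spectral_diag A.
have Pun : P \is unitarymx := spectral_unitarymx A.
have Pu : P \in unitmx := spectral_unit A.
move=> AE chA a0 cnt uA u0 vu.
have dcnt i j : ~~ (a <= d 0 i) -> ~~ (a <= d 0 j) -> i = j.
  move=> hi hj.
  have perm : perm_eq s [seq d 0 i | i <- enum 'I_N].
    apply: prod_XsubC_eq; rewrite -chA AE char_poly_conj //.
    rewrite char_poly_trig ?diag_mx_is_trig // big_map big_enum /=.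
    by apply: eq_bigr => l _; rewrite mxE eqxx.
  have /card_le1_eqP : (#|[pred l | ~~ (a <= d 0 l)%R]| <= 1)%N.
    by move: cnt; rewrite (permP perm) count_map -size_filter cardE enumT.
  by apply.
pose w := u *m invmx P; pose z := v *m invmx P.
have wd i : w 0 i * d 0 i = 0.
  have : w *m diag_mx d = 0.
    have -> : w *m diag_mx d = u *m A *m invmx P by rewrite AE !mulmxA mulmxK.
    by rewrite uA mul0mx.
  by move=> /rowP/(_ i); rewrite mul_mx_diag !mxE.
have [i0 wi0] : exists i, w 0 i != 0.
  apply/rV0Pn; apply: contra_neq u0 => w0.
  by rewrite -[u](mulmxKV Pu) -/w w0 mul0mx.
have di0 : d 0 i0 = 0 by apply/eqP; have /eqP := wd i0; rewrite mulf_eq0 (negPf wi0).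
have w0 i : i != i0 -> w 0 i = 0.
  move=> ii0; apply/eqP; have /eqP := wd i; rewrite mulf_eq0 => /orP[//|/eqP di].
  case/eqP: ii0; apply: dcnt; by rewrite ?di ?di0 lt_geF.
have PV : P *m P^t* = 1%:M by apply/unitarymxP.
have zE : v = z *m P by rewrite /z mulmxKV.
have wE : u = w *m P by rewrite /w mulmxKV.
have vz : v *m invmx P = z by [].
clearbody w z.
have trC m n p (X : 'M[C]_(m, n)) (Y : 'M_(n, p)) : (X *m Y)^t* = Y^t* *m X^t*.
  by rewrite trmx_mul map_mxM.
have zi0 : z 0 i0 = 0.
  move: vu; rewrite zE wE trC mulmxA -(mulmxA z) PV mulmx1 => /rowP/(_ 0).
  rewrite !mxE (bigD1 i0) //= big1 ?addr0 => [|i /w0 wi]; last first.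
    by rewrite !mxE wi conjC0 mulr0.
  by move/eqP; rewrite !mxE mulf_eq0 conjC_eq0 (negPf wi0) orbF => /eqP.
have -> : v *m v^t* = z *m z^t* by rewrite zE trC mulmxA -(mulmxA z) PV mulmx1.
have -> : v *m A *m v^t* = z *m diag_mx d *m z^t*.
  rewrite [in LHS]AE !mulmxA vz zE trC !mulmxA.
  by rewrite -(mulmxA _ P (P^t*)) PV mulmx1.
rewrite mul_mx_diag !mxE mulr_sumr; apply: ler_sum => i _; rewrite !mxE.
have [->|ii0] := eqVneq i i0; first by rewrite zi0 !mul0r mulr0.
rewrite -[z 0 i * d 0 i]mulrC -mulrA ler_wpM2r ?mul_conjC_ge0 //.
by apply: contraNT ii0 => /dcnt h; apply/eqP/h; rewrite di0 lt_geF.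
Qed.

(** The spectral theorem is applied over [R[i]]; since [s] is sorted, only its head can lie below
    [lam]. *)
Lemma symmetric_gap (R : rcfType) N (L : 'M[R]_N) (s : seq R) (lam : R)
    (u v : 'rV[R]_N) :
  L^T = L -> sorted <=%R s -> char_poly L = \prod_(x <- s) ('X - x%:P) ->
  0 < lam <= s`_1 -> u *m L = 0 -> u != 0 -> v *m u^T = 0 ->
  lam * (v *m v^T) 0 0 <= (v *m L *m v^T) 0 0.
Proof.
move=> Lsym ss chL /andP[lam0 lams] uL u0 vu.
pose f : {rmorphism R -> R[i]} := real_complex R.
have fr m n (X : 'M[R]_(m, n)) : map_mx f X \is a realmx.
  apply/mxOverP => i j; rewrite mxE; apply/complex_realP; by exists (X i j).
have ftr m n (X : 'M[R]_(m, n)) : (map_mx f X)^t* = map_mx f X^T.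
  by rewrite map_trmx realmxC.
rewrite -lecR rmorphM /=.
have -> : ((v *m v^T) 0 0)%:C%C = (map_mx f v *m (map_mx f v)^t*) 0 0.
  by rewrite ftr -map_mxM [RHS]mxE.
have -> : ((v *m L *m v^T) 0 0)%:C%C = (map_mx f v *m map_mx f L *m (map_mx f v)^t*) 0 0.
  by rewrite ftr -!map_mxM [RHS]mxE.
apply: (@normalmx_gap _ _ _ (map f s) _ (map_mx f u)).
- apply: symmetric_normalmx => //.
  by apply/is_hermitianmxP; rewrite expr0 scale1r map_mx_id // map_trmx Lsym.
- by rewrite -map_char_poly chL map_prod_XsubC big_map.
- by rewrite ltcR.
- rewrite count_map; case: s ss lams {chL} => [|x [|y s]] //; first by rewrite /= addn0 leq_b1.
  rewrite [sorted _ _]/= [nth _ _ _]/= => /andP[_ ps] lamy.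
  rewrite -cat1s count_cat [count _ (y :: s)](_ : _ = 0%N).
    by rewrite addn0 /= addn0 leq_b1.
  apply/eqP; rewrite -leqn0 leqNgt -has_count; apply/hasPn => z zs /=.
  rewrite negbK lecR; apply: le_trans lamy _.
  move: zs; rewrite inE => /orP[/eqP->//|zs].
  by move: ps; rewrite (path_sortedE le_trans) => /andP[/allP/(_ _ zs)].
- by rewrite -map_mxM uL map_mx0.
- by rewrite map_mx_eq0.
- by rewrite ftr -map_mxM vu map_mx0.
Qed.
End SpectralGap.

(** Subtracting from [v] its projection on the unit null vector [u] keeps the form and lowers the
    squared norm by the squared inner product. *)
Lemma symmetric_gap_unit (R : rcfType) N (L : 'M[R]_N) (s : seq R) (lam : R)
    (u v : 'rV[R]_N) :
  L^T = L -> sorted <=%R s -> char_poly L = \prod_(x <- s) ('X - x%:P) ->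
  0 < lam <= s`_1 -> u *m L = 0 -> u *m u^T = 1%:M ->
  lam * ((v *m v^T) 0 0 - (v *m u^T) 0 0 ^+ 2) <= (v *m L *m v^T) 0 0.
Proof.
move=> Lsym ss chL lams uL uu; set c := (v *m u^T) 0 0.
have vu : v *m u^T = c%:M by apply: mx11_scalar.
have uv : u *m v^T = c%:M by rewrite -[LHS]trmxK trmx_mul trmxK vu tr_scalar_mx.
have u0 : u != 0.
  by apply: contra_eqN uu => /eqP->; rewrite mul0mx eq_sym oner_eq0.
have Lu : L *m u^T = 0 by rewrite -[LHS]trmxK trmx_mul trmxK Lsym uL trmx0.
have := @symmetric_gap R N L s lam u (v - c *: u) Lsym ss chL lams uL u0.
rewrite mulmxBl -scalemxAl vu uu scale_scalar_mx mulr1 subrr => /(_ erefl).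
have -> : (v - c *: u)^T = v^T - c *: u^T by apply/matrixP => i j; rewrite !mxE.
rewrite [(v - _) *m L]mulmxBl -[_ *: u *m L]scalemxAl uL scaler0 subr0.
rewrite (mulmxBr (v *m L)) -(scalemxAr _ (v *m L)) -[v *m L *m u^T]mulmxA Lu.
rewrite mulmx0 scaler0 subr0 mulmxBr !mulmxBl -!scalemxAr -!scalemxAl vu uv uu.
rewrite !scale_scalar_mx mulr1 subrr subr0; congr (lam * _ <= _).
by rewrite !mxE eqxx mulr1n expr2.
Qed.

(** * Poincare inequality for the connection graph *)

Section GlauberKernel.
Variables (R : realType) (k : nat) (Q : 'I_k -> finType) (mu : {ffun qtuple Q -> R}).
Hypothesis muD : is_distr mu.
Implicit Types (t : 'I_k) (x y z : qtuple Q) (F : qtuple Q -> R).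

Let mu0 x : 0 <= mu x. Proof. by case: muD. Qed.

Lemma agree_refl t x : agree_except t x x.
Proof. by apply/forallP => s; apply/implyP. Qed.

Lemma agree_sym t x y : agree_except t x y = agree_except t y x.
Proof. by apply: eq_forallb => s; rewrite [x s == _]eq_sym. Qed.

Lemma agree_trans t x y z :
  agree_except t x y -> agree_except t x z = agree_except t y z.
Proof.
move=> /forallP h; apply: eq_forallb => s; have := h s.
by case: (s != t) => //= /eqP->.
Qed.

Lemma marg_eq t x y : agree_except t x y -> marg mu t x = marg mu t y.
Proof. by move=> h; apply: eq_bigl => z; rewrite (agree_trans z h). Qed.

Lemma marg_ge0 t x : 0 <= marg mu t x.
Proof. exact: sumr_ge0. Qed.

Lemma marg0 t x : marg mu t x = 0 -> mu x = 0.
Proof.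
move=> m0; apply/eqP; rewrite eq_le mu0 andbT -m0 /marg (bigD1 x) ?agree_refl //=.
by rewrite lerDl sumr_ge0.
Qed.

(* [marg mu t x = 0] leaves the conditional distribution undefined: the point
   mass at [x] keeps [kern t x] a probability distribution. *)
Definition kern t x y : R :=
  if marg mu t x == 0 then (y == x)%:R
  else (agree_except t x y)%:R * mu y / marg mu t x.

Lemma kern_ge0 t x y : 0 <= kern t x y.
Proof.
by rewrite /kern; case: ifP => _; rewrite ?divr_ge0 ?mulr_ge0 ?marg_ge0 ?ler0n.
Qed.

Lemma kern_sum t x : \sum_y kern t x y = 1.
Proof.
rewrite /kern; have [_|m0] := eqVneq (marg mu t x) 0.
  by rewrite (bigD1 x) //= eqxx big1 ?addr0 // => y /negPf->.
rewrite -mulr_suml -[X in X / _](_ : marg mu t x = _) ?divff //.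
by rewrite /marg big_mkcond; apply: eq_bigr => y _; case: ifP => _; rewrite ?mul1r ?mul0r.
Qed.

Lemma mu_kernE t x y :
  mu x * kern t x y = (agree_except t x y)%:R * (mu x * mu y / marg mu t x).
Proof.
rewrite /kern; have [m0|m0] := eqVneq (marg mu t x) 0; last by ring.
by rewrite (marg0 m0) !mul0r mulr0.
Qed.

(** Detailed balance: resampling the question of player [t] is reversible for [mu]. *)
Lemma mu_kernC t x y : mu x * kern t x y = mu y * kern t y x.
Proof.
rewrite !mu_kernE (agree_sym t y x).
have [h|_] := boolP (agree_except t x y); last by rewrite !mul0r.
by rewrite (marg_eq h) [mu y * _]mulrC.
Qed.

Lemma mu_kern_sum t y : \sum_x mu x * kern t x y = mu y.
Proof. by under eq_bigr do rewrite mu_kernC; rewrite -mulr_sumr kern_sum mulr1. Qed.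

(** All points reachable from [x] share its conditional distribution, so [kern t] is idempotent. *)
Lemma kern_const t x y F : kern t x y != 0 ->
  \sum_z kern t y z * F z = \sum_z kern t x z * F z.
Proof.
have [-> //|yx] := eqVneq y x; rewrite /kern (negPf yx).
have [_|m0] := eqVneq (marg mu t x) 0; first by rewrite eqxx.
have [h _|_] := boolP (agree_except t x y); last by rewrite !mul0r eqxx.
rewrite -(marg_eq h) (negPf m0); apply: eq_bigr => z _.
by rewrite (agree_trans z h).
Qed.

(** A reversible idempotent kernel is an orthogonal projection [T] in [L^2(mu)]; this is
    [|T F|^2 = <F, T F>]. *)
Lemma kern_proj t F :
  \sum_x mu x * (\sum_y kern t x y * F y) ^+ 2 =
  \sum_x mu x * F x * \sum_y kern t x y * F y.
Proof.
pose T x := \sum_y kern t x y * F y.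
transitivity (\sum_x \sum_y mu x * kern t x y * (F y * T x)).
  apply: eq_bigr => x _; rewrite expr2 -/(T x) {1}/T mulr_suml mulr_sumr.
  by apply: eq_bigr => y _; ring.
transitivity (\sum_x \sum_y mu y * F y * (kern t y x * T y)).
  apply: eq_bigr => x _; apply: eq_bigr => y _; rewrite mu_kernC.
  have [->|kyx] := eqVneq (kern t y x) 0; first by ring.
  by rewrite /T (kern_const F kyx); ring.
rewrite exchange_big /=; apply: eq_bigr => y _.
by rewrite -mulr_sumr -mulr_suml kern_sum mul1r.
Qed.

Hypothesis k0 : (0 < k)%N.

(** The connection graph is the Glauber dynamics of [mu]: resample the question of a uniform player
    given all the others. *)
Lemma rhoE x y : rho mu x y = k%:R^-1 * \sum_t mu x * kern t x y.
Proof.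
have mc t z : marg mu t z * cond mu t z = mu z.
  rewrite /cond; have [m0|m0] := eqVneq (marg mu t z) 0; last by rewrite mulrC divfK.
  by rewrite (marg0 m0) m0 mul0r.
rewrite /rho; have [<-|xy] := eqVneq x y.
  rewrite -mulrA mulr_sumr; congr (_ * _); apply: eq_bigr => t _.
  by rewrite mu_kernE agree_refl mul1r /cond mulrA.
congr (_ * _); apply: eq_bigr => t _; rewrite mu_kernE mc /cond.
have [h|_] := boolP (agree_except t x y); last by rewrite !mul0r.
by rewrite (marg_eq h) !mulrA.
Qed.

Lemma rho1E x : rho1 mu x = mu x.
Proof.
rewrite /rho1; under eq_bigr do rewrite rhoE.
rewrite -mulr_sumr exchange_big /=.
under eq_bigr do rewrite -mulr_sumr kern_sum mulr1.
by rewrite sumr_const card_ord -[mu x *+ k]mulr_natl mulrA mulVf ?mul1r // pnatr_eq0 -lt0n.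
Qed.

Lemma rhoC x y : rho mu x y = rho mu y x.
Proof. by rewrite !rhoE; congr (_ * _); apply: eq_bigr => t _; rewrite mu_kernC. Qed.

Lemma mem_supp x : (x \in Defs.support mu) = (mu x != 0).
Proof. by rewrite /Defs.support in_set rho1E lt_def mu0 andbT. Qed.

Lemma sum_vtx (H : qtuple Q -> R) : (forall x, mu x = 0 -> H x = 0) ->
  \sum_i H (vtx (mu := mu) i) = \sum_x H x.
Proof.
move=> H0; rewrite /vtx -(big_enum_val (idx := 0) (op := +%R) H) /=.
rewrite big_mkcond /=; apply: eq_bigr => x _; rewrite mem_supp.
by case: eqP => //= /H0.
Qed.

Lemma laplacianE i j : laplacian mu i j =
  (i == j)%:R - rho mu (vtx i) (vtx j) / (Num.sqrt (mu (vtx i)) * Num.sqrt (mu (vtx j))).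
Proof.
rewrite mxE !rho1E; case: eqP => [->|_]; last by rewrite sqrtrM // sub0r mulNr.
by rewrite -expr2 sqr_sqrtr.
Qed.

(** Scaling by [sqrt mu] carries the inner product of [L^2(mu)] to the Euclidean one, for which the
    normalised Laplacian is symmetric. *)
Let vec F : 'rV[R]_#|Defs.support mu| := \row_i (Num.sqrt (mu (vtx i)) * F (vtx i)).

Lemma vec_dot F F' : (vec F *m (vec F')^T) 0 0 = \sum_x mu x * (F x * F' x).
Proof.
rewrite mxE -(sum_vtx (H := fun x => mu x * (F x * F' x))) => [|x ->]; last by rewrite mul0r.
by apply: eq_bigr => i _; rewrite !mxE mulrACA -expr2 sqr_sqrtr.
Qed.

Lemma vtx_neq0 i : Num.sqrt (mu (vtx (mu := mu) i)) != 0.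
Proof.
have := enum_valP i; rewrite mem_supp => h.
by rewrite sqrtr_eq0 -ltNge lt_def h mu0.
Qed.

Lemma rho0 x y : mu y = 0 -> rho mu x y = 0.
Proof.
move=> y0; rewrite rhoE big1 ?mulr0 // => t _.
by rewrite mu_kernC y0 mul0r.
Qed.

Lemma vec_laplacian F :
  vec F *m laplacian mu =
  \row_j (Num.sqrt (mu (vtx j)) * F (vtx j) -
          (\sum_x rho mu x (vtx j) * F x) / Num.sqrt (mu (vtx j))).
Proof.
apply/rowP => j; rewrite !mxE.
under eq_bigr => i _ do rewrite laplacianE mulrBr.
rewrite sumrB (bigD1 j) //= eqxx mulr1 big1 ?addr0; last first.
  by move=> i /negPf->; rewrite mulr0.
rewrite !mxE; congr (_ - _).
rewrite -(sum_vtx (H := fun x => rho mu x (vtx j) * F x)); last first.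
  by move=> x x0; rewrite rhoC rho0 ?mul0r.
rewrite mulr_suml; apply: eq_bigr => i _; rewrite mxE.
by field; rewrite !vtx_neq0.
Qed.

Lemma laplacian_form F :
  (vec F *m laplacian mu *m (vec F)^T) 0 0 =
  \sum_x mu x * F x ^+ 2 - \sum_y F y * (\sum_x rho mu x y * F x).
Proof.
rewrite vec_laplacian mxE.
rewrite -(sum_vtx (H := fun x => mu x * F x ^+ 2)) => [|x ->]; last by rewrite mul0r.
rewrite -(sum_vtx (H := fun y => F y * (\sum_x rho mu x y * F x))); last first.
  by move=> y y0; rewrite big1 ?mulr0 // => x _; rewrite rho0 ?mul0r.
rewrite -sumrB; apply: eq_bigr => j _; rewrite !mxE.
rewrite -[mu (vtx j) in RHS](sqr_sqrtr (mu0 _)).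
by field; rewrite vtx_neq0.
Qed.

Lemma laplacian_sym : (laplacian mu)^T = laplacian mu.
Proof.
apply/matrixP => i j; rewrite mxE !laplacianE eq_sym rhoC.
by rewrite [Num.sqrt _ * _]mulrC.
Qed.

(** The walk is an average of orthogonal projections, so its Dirichlet form is the mean variance of
    [F] when one random player's question is resampled. *)
Lemma laplacian_energy F :
  (vec F *m laplacian mu *m (vec F)^T) 0 0 =
  \sum_(s : 'I_k * qtuple Q) mu s.2 / k%:R *
    (\sum_y kern s.1 s.2 y * F y ^+ 2 - (\sum_y kern s.1 s.2 y * F y) ^+ 2).
Proof.
rewrite laplacian_form.
rewrite -(pair_bigA _ (fun t x => mu x / k%:R *
    (\sum_y kern t x y * F y ^+ 2 - (\sum_y kern t x y * F y) ^+ 2))) /=.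
have -> : \sum_x mu x * F x ^+ 2 =
    \sum_(t < k) k%:R^-1 * \sum_x mu x * F x ^+ 2.
  rewrite -mulr_suml sumr_const card_ord -[_ *+ k]mulr_natl mulfV ?mul1r //.
  by rewrite pnatr_eq0 -lt0n.
have -> : \sum_y F y * (\sum_x rho mu x y * F x) =
    \sum_(t < k) k%:R^-1 * \sum_x mu x * (\sum_y kern t x y * F y) ^+ 2.
  rewrite -mulr_sumr.
  under [in RHS]eq_bigr do rewrite kern_proj.
  rewrite exchange_big mulr_sumr /=; apply: eq_bigr => y _.
  under eq_bigr do rewrite rhoC rhoE.
  rewrite -mulr_sumr mulrCA; under eq_bigr do rewrite -mulrA mulr_suml.
  rewrite -mulr_sumr mulr_sumr exchange_big /= !mulr_sumr.
  apply: eq_bigr => t _; rewrite !mulr_sumr; apply: eq_bigr => x _; ring.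
rewrite -sumrB; apply: eq_bigr => t _; rewrite -mulrBr.
have -> : \sum_x mu x * F x ^+ 2 = \sum_x mu x * (\sum_y kern t x y * F y ^+ 2).
  under [in RHS]eq_bigr do rewrite mulr_sumr.
  rewrite exchange_big; apply: eq_bigr => y _ /=.
  by under eq_bigr do rewrite mulrA; rewrite -mulr_suml mu_kern_sum.
rewrite -sumrB mulr_sumr; apply: eq_bigr => x _; ring.
Qed.

(** The constant function gives a unit null vector of the Laplacian, and projecting it away
    subtracts the squared mean of [F]. *)
Lemma glauber_poincare lam F : 0 < lam -> is_expander mu lam ->
  lam * (\sum_x mu x * F x ^+ 2 - (\sum_x mu x * F x) ^+ 2) <=
  \sum_(s : 'I_k * qtuple Q) mu s.2 / k%:R *
    (\sum_y kern s.1 s.2 y * F y ^+ 2 - (\sum_y kern s.1 s.2 y * F y) ^+ 2).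
Proof.
move=> lam0 [l [[s [ss chL <-]] laml]]; rewrite -laplacian_energy.
have -> : \sum_x mu x * F x ^+ 2 = (vec F *m (vec F)^T) 0 0 by rewrite vec_dot.
have -> : \sum_x mu x * F x = (vec F *m (vec (fun=> 1))^T) 0 0.
  by rewrite vec_dot; under [RHS]eq_bigr do rewrite mulr1.
apply: (@symmetric_gap_unit _ _ _ s _ (vec (fun=> 1)) (vec F) laplacian_sym ss chL).
  by rewrite lam0.
  rewrite vec_laplacian; apply/rowP => j; rewrite !mxE.
  under eq_bigr do rewrite mulr1 rhoC.
  rewrite -[\sum_x _]/(rho1 mu (vtx j)) rho1E -[X in X / _](sqr_sqrtr (mu0 _)).
  by field; rewrite vtx_neq0.
rewrite [LHS]mx11_scalar vec_dot; congr (_%:M).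
by under eq_bigr do rewrite !mulr1; case: muD.
Qed.

End GlauberKernel.

(** With no players [0^-1 = 0] kills every edge weight, so the Laplacian is an empty matrix and its
    second eigenvalue is the default 0 of [nth]. *)
Lemma expander_players (R : realType) (k : nat) (Q : 'I_k -> finType)
    (mu : {ffun qtuple Q -> R}) lam : 0 < lam -> is_expander mu lam -> (0 < k)%N.
Proof.
move=> lam0 [l [[s [_ chL <-]] laml]]; rewrite lt0n; apply/negP => /eqP k0.
have N0 : #|Defs.support mu| = 0%N.
  apply/eqP; rewrite cards_eq0; apply/eqP/setP => x; rewrite !inE /rho1.
  rewrite big1 ?ltxx // => y _; rewrite /rho.
  have -> : k%:R^-1 = 0 :> R by rewrite k0 invr0.
  by rewrite !mul0r if_same.
have := size_char_poly (laplacian mu); rewrite chL size_prod_XsubC N0 => -[s0].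
by move: laml; rewrite nth_default ?s0 // leNgt lam0.
Qed.

(** * Repeated game conditioned on transcripts *)

Section Players.
Variables (R : realType) (k : nat) (Q : 'I_k -> finType).

(** Only the question of player [t] is random under [K]; the marginals of all other players are
    point masses. *)
Lemma product_kernel (K : qtuple Q -> R) t x y :
  \sum_z K z = 1 -> (forall z, ~~ agree_except t x z -> K z = 0) ->
  K y = \prod_(u < k) \sum_(z : qtuple Q | z u == y u) K z.
Proof.
move=> K1 K0.
have Kx u (z : qtuple Q) : u != t -> z u != x u -> K z = 0.
  by move=> ut zu; apply: K0; apply/forallPn; exists u; rewrite ut eq_sym.
have [xy|xy] := boolP (agree_except t x y).
  rewrite (bigD1 t) //= [X in _ = _ * X]big1 => [|u ut].
    rewrite mulr1 (bigD1 y) //= big1 ?addr0 // => z /andP[/eqP zt zy].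
    apply: K0; apply: contraNN zy => xz; apply/eqP/ffunP => u.
    have [->//|ut] := eqVneq u t.
    by move/forallP: xz => /(_ u); move/forallP: xy => /(_ u); rewrite ut => /eqP <- /eqP <-.
  rewrite -K1 big_mkcond /=; apply: eq_bigr => z _.
  case: eqP => // zy; rewrite (Kx u) //; apply/eqP => zx; case: zy; rewrite zx.
  by move/forallP: xy => /(_ u); rewrite ut => /eqP.
rewrite (K0 _ xy); move/forallPn: xy => [u]; rewrite negb_imply => /andP[ut xyu].
rewrite (bigD1 u) //= big1 ?mul0r // => z /eqP zu.
by rewrite (Kx u) // zu eq_sym.
Qed.

Variable n : nat.

(** The repeated game groups questions by player, the product measure by coordinate; this
    transposition passes between them. *)
Definition player_view (z : {ffun 'I_n -> qtuple Q}) : qtuple (rep_fam n Q) :=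
  finfun (fun t : 'I_k => [ffun j => z j t] : rep_fam n Q t).

Definition question_tuples (y : qtuple (rep_fam n Q)) : {ffun 'I_n -> qtuple Q} :=
  [ffun j => Defs.coord y j].

Lemma player_viewE z t j : player_view z t j = z j t.
Proof. by rewrite /player_view !ffunE. Qed.

Lemma coord_player_view z j : Defs.coord (player_view z) j = z j.
Proof. by apply/ffunP => t; rewrite ffunE player_viewE. Qed.

Lemma player_viewK : cancel player_view question_tuples.
Proof. by move=> z; apply/ffunP => j; rewrite ffunE coord_player_view. Qed.

Lemma question_tuplesK : cancel question_tuples player_view.
Proof.
by move=> y; apply/ffunP => t; apply/ffunP => j; rewrite player_viewE !ffunE.
Qed.

Lemma player_view_bij : bijective player_view.
Proof. exists question_tuples; [exact: player_viewK | exact: question_tuplesK]. Qed.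

(** If the questions are independent over players as well, the mean of a product over players
    factors. *)
Lemma sum_players (m : 'I_n -> forall t, Q t -> R)
    (Phi : forall t, {ffun 'I_n -> Q t} -> R) :
  \sum_(z : {ffun 'I_n -> qtuple Q})
     (\prod_j \prod_t m j t (z j t)) * \prod_t Phi t (player_view z t) =
  \prod_t \sum_(phi : {ffun 'I_n -> Q t}) (\prod_j m j t (phi j)) * Phi t phi.
Proof.
rewrite -(sum_dffun_prod (T := rep_fam n Q) (fun t phi => (\prod_j m j t (phi j)) * Phi t phi)).
rewrite (reindex player_view) /=; last exact/onW_bij/player_view_bij.
apply: eq_bigr => z _; rewrite big_split /= exchange_big; congr (_ * _).
by apply: eq_bigr => t _; apply: eq_bigr => j _; rewrite player_viewE.
Qed.

End Players.

Section Repetition.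
Variables (R : realType) (k : nat) (Q A : 'I_k -> finType) (G : game R Q A).
Variables (n : nat) (f : strategy (rep_fam n Q) (rep_fam n A)).
Hypothesis muD : is_distr (gmu G).
Let mu0 x : 0 <= gmu G x. Proof. by case: muD. Qed.
Let mu1 : \sum_x gmu G x = 1. Proof. by case: muD. Qed.

Local Notation Z := {ffun 'I_n -> qtuple Q}.

Definition resp (z : Z) (i : 'I_n) : qtuple A :=
  Defs.coord (answers f (player_view z)) i.

Definition won (C : {set 'I_n}) (z : Z) : bool :=
  [forall i in C, gV G (z i) (resp z i)].

Definition win_on C : R := expect (fun=> gmu G) (fun z => (won C z)%:R).

Lemma respE z i t : resp z i t = f t (player_view z t) i.
Proof. by rewrite /resp /Defs.coord !ffunE. Qed.

Lemma win_prob_rep : win_prob (rep_game G n) f = win_on setT.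
Proof.
rewrite /win_prob (reindex (@player_view k Q n)) /=; last exact/onW_bij/player_view_bij.
apply: eq_bigr => z _; rewrite ffunE.
congr (_ * _%:R).
  by apply: eq_bigr => i _; rewrite coord_player_view.
by congr nat_of_bool; apply: eq_forallb => i; rewrite inE coord_player_view.
Qed.

Lemma win_on_subset (C D : {set 'I_n}) : C \subset D -> win_on D <= win_on C.
Proof.
move=> CD; apply: ler_expect => // z; rewrite ler_nat.
case: (boolP (won D z)) => // /forall_inP wD.
by rewrite (_ : won C z) //; apply/forall_inP => i /(subsetP CD) /wD.
Qed.

Lemma win_on0 : win_on set0 = 1.
Proof.
rewrite -[RHS](expect1 (I := 'I_n) (nu := fun=> gmu G)) //; apply: eq_expect => z.
by rewrite (_ : won set0 z) //; apply/forall_inP => i; rewrite inE.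
Qed.

(** * Adding one coordinate to the set of won coordinates *)

Section Step.
Variables (C : {set 'I_n}).
Local Notation trans := {ffun {i : 'I_n | i \in C} -> qtuple A}.
Local Notation S := ('I_k * qtuple Q)%type.

(** For fixed answers [a], winning on [C] splits into [replies], a product event over the players,
    and [accepted], which depends only on the questions in [C]. *)
Definition replies (a : trans) (z : Z) : bool := [forall c, resp z (val c) == a c].
Definition accepted (a : trans) (z : Z) : bool := [forall c, gV G (z (val c)) (a c)].

(* What [s = (t, x)] reveals: everything but the question of player [t], or all
   of [x] for the coordinates in [C]. *)
Definition frozen_kern (j : 'I_n) (s : S) (y : qtuple Q) : R :=
  if j \in C then (y == s.2)%:R else kern (gmu G) s.1 s.2 y.

Local Notation cond_dist r := (fun j => frozen_kern j ((r : {ffun 'I_n -> S}) j)).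

Lemma frozen_kern_ge0 j s y : 0 <= frozen_kern j s y.
Proof. by rewrite /frozen_kern; case: ifP => _; rewrite ?ler0n // kern_ge0. Qed.

Lemma frozen_kern_sum j s : \sum_y frozen_kern j s y = 1.
Proof.
rewrite /frozen_kern; case: (j \in C); last exact: kern_sum.
by rewrite (bigD1 s.2) //= eqxx big1 ?addr0 // => y /negPf->.
Qed.

Lemma frozen_kern_agree j s y :
  ~~ agree_except s.1 s.2 y -> frozen_kern j s y = 0.
Proof.
move=> h; have ys : (y == s.2) = false.
  by apply: contraNF h => /eqP->; exact: agree_refl.
by rewrite /frozen_kern /kern ys (negPf h) !mul0r !if_same.
Qed.

Definition frozen_marg (j : 'I_n) (s : S) (t : 'I_k) (q : Q t) : R :=
  \sum_(z : qtuple Q | z t == q) frozen_kern j s z.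

Lemma frozen_kernE j s y : frozen_kern j s y = \prod_t frozen_marg j s (y t).
Proof. exact: (product_kernel y (frozen_kern_sum j s) (@frozen_kern_agree j s)). Qed.

Lemma frozen_marg_ge0 j s t (q : Q t) : 0 <= frozen_marg j s q.
Proof. by apply: sumr_ge0 => z _; exact: frozen_kern_ge0. Qed.

(** This is the [g_i x] of the overview; overwriting coordinate [i] makes it independent of
    [r i]. *)
Definition cond_mass (a : trans) (r : {ffun 'I_n -> S}) (i : 'I_n) (x : qtuple Q) : R :=
  expect (cond_dist r) (fun y => (replies a (upd y i x))%:R).

Lemma player_view_upd (y : Z) i x t :
  player_view (upd y i x) t = upd (player_view y t) i (x t).
Proof.
by apply/ffunP => j; rewrite player_viewE !ffunE; case: eqP => // _; rewrite player_viewE.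
Qed.

(** Given [r], let [Psi t q b] be the probability that player [t], asked [q] at [i], replies [a] on
    [C] and [b] at [i]. These masses multiply over players, as [one_shot] requires. *)
Lemma cond_one_shot a r i eps : 0 <= eps -> game_val G <= 1 - eps ->
  \sum_x gmu G x * expect (cond_dist r) (fun y =>
     (replies a (upd y i x))%:R * (gV G x (resp (upd y i x) i))%:R) <=
  (1 - eps / 2) * (\sum_x gmu G x * cond_mass a r i x) +
  2 * var_sqrt (gmu G) (cond_mass a r i).
Proof.
move=> eps0 valG.
pose Phi t (q : Q t) (b : A t) (phi : {ffun 'I_n -> Q t}) : R :=
  ([forall c, f t (upd phi i q) (val c) == a c t] && (f t (upd phi i q) i == b))%:R.
pose Psi t (q : Q t) (b : A t) : R :=
  \sum_(phi : {ffun 'I_n -> Q t}) (\prod_j frozen_marg j (r j) (phi j)) * Phi t q b phi.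
have PsiE x (b : qtuple A) : expect (cond_dist r) (fun y =>
    (replies a (upd y i x) && (resp (upd y i x) i == b))%:R) = \prod_t Psi t (x t) (b t).
  rewrite -(sum_players (fun j t q => frozen_marg j (r j) q) (fun t => Phi t (x t) (b t))).
  apply: eq_bigr => y _; congr (_ * _).
    by apply: eq_bigr => j _; exact: frozen_kernE.
  rewrite -natr_forall; congr (_%:R); congr nat_of_bool.
  apply/andP/forallP => [[/forallP ra /eqP rb] t|h].
    rewrite -player_view_upd -respE rb eqxx andbT; apply/forallP => c.
    by rewrite -respE (eqP (ra c)).
  split.
    apply/forallP => c; apply/eqP/ffunP => t.
    by have /andP[/forallP/(_ c)/eqP] := h t; rewrite -player_view_upd -respE.
  apply/eqP/ffunP => t.
  by have /andP[_ /eqP] := h t; rewrite -player_view_upd -respE.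
have Psi0 t q b : 0 <= Psi t q b.
  by apply: sumr_ge0 => phi _; rewrite mulr_ge0 ?ler0n // prodr_ge0 // => j _;
    exact: frozen_marg_ge0.
have -> : \sum_x gmu G x * expect (cond_dist r) (fun y =>
     (replies a (upd y i x))%:R * (gV G x (resp (upd y i x) i))%:R) =
   \sum_x gmu G x * (\sum_(b : qtuple A) (gV G x b)%:R * \prod_t Psi t (x t) (b t)).
  apply: eq_bigr => x _; congr (_ * _).
  under [RHS]eq_bigr do rewrite -PsiE -expectZ.
  rewrite -expect_sum; apply: eq_expect => y.
  rewrite (bigD1 (resp (upd y i x) i)) //= eqxx andbT big1 ?addr0 1?mulrC // => b.
  by rewrite eq_sym => /negPf->; rewrite andbF mulr0.
(* Any default answer serves; this one shows that an answer exists. *)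
apply: (one_shot muD (fun t q => f t [ffun=> q] i)) => // x.
under [RHS]eq_bigr do rewrite -PsiE.
rewrite -expect_sum; apply: eq_expect => y.
rewrite (bigD1 (resp (upd y i x) i)) //= eqxx andbT big1 ?addr0 // => b.
by rewrite eq_sym => /negPf->; rewrite andbF.
Qed.

(** On [C] the kernel is a point mass at the revealed question, so [accepted] is a constant given
    [r]. *)
Lemma expect_frozen a (r : {ffun 'I_n -> S}) H :
  expect (cond_dist r) (fun y => (accepted a y)%:R * H y) =
  (accepted a [ffun j => (r j).2])%:R * expect (cond_dist r) H.
Proof.
rewrite -expectZ; apply: eq_bigr => y _.
have [h|/forallPn[j]] := boolP [forall j, (j \in C) ==> (y j == (r j).2)].
  congr (_ * (_%:R * _)); congr nat_of_bool; apply: eq_forallb => c.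
  by rewrite ffunE; have /forall_inP/(_ _ (valP c))/eqP -> := h.
rewrite negb_imply => /andP[jC yj].
by rewrite (bigD1 j) //= {1 3}/frozen_kern jC (negPf yj) !mul0r.
Qed.

Definition pair_dist (s : S) : R := gmu G s.2 / k%:R.

Hypothesis k0 : (0 < k)%N.

Lemma pair_dist_ge0 s : 0 <= pair_dist s.
Proof. by rewrite divr_ge0 ?ler0n. Qed.

Lemma pair_dist_sum : \sum_s pair_dist s = 1.
Proof.
rewrite -(pair_bigA _ (fun (_ : 'I_k) x => gmu G x / k%:R)) /=.
rewrite sumr_const card_ord -mulr_suml mu1 mul1r -[_ *+ k]mulr_natl mulfV //.
by rewrite pnatr_eq0 -lt0n.
Qed.

(** Outside [C] this is stationarity of [mu] under each kernel; inside [C] the question is simply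
    copied. *)
Lemma frozen_mix j x : \sum_s pair_dist s * frozen_kern j s x = gmu G x.
Proof.
rewrite -(pair_bigA _ (fun t y => gmu G y / k%:R * frozen_kern j (t, y) x)) /=.
transitivity (\sum_(t < k) k%:R^-1 * gmu G x); last first.
  by rewrite sumr_const card_ord -[_ *+ k]mulr_natl mulrA mulfV ?mul1r // pnatr_eq0 -lt0n.
apply: eq_bigr => t _; under eq_bigr do rewrite mulrAC mulrC.
rewrite -mulr_sumr; congr (_ * _); rewrite /frozen_kern /=.
case: (j \in C); last exact: mu_kern_sum.
rewrite (bigD1 x) //= eqxx mulr1 big1 ?addr0 // => y.
by rewrite eq_sym => /negPf->; rewrite mulr0.
Qed.

Lemma expect_accepted a H :
  expect (fun=> gmu G) (fun z => (accepted a z)%:R * H z) =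
  expect (fun=> pair_dist) (fun r : {ffun 'I_n -> S} =>
    (accepted a [ffun j => (r j).2])%:R * expect (cond_dist r) H).
Proof.
rewrite (expect_mix _ frozen_mix); apply: eq_expect => r; exact: expect_frozen.
Qed.

(** Exactly one [a], the actual replies, contributes. *)
Lemma wonE z : (won C z)%:R = \sum_a (accepted a z)%:R * (replies a z)%:R :> R.
Proof.
pose a0 : trans := [ffun c => resp z (val c)].
rewrite (bigD1 a0) //= big1 ?addr0 => [|a aa0].
  have -> : replies a0 z by apply/forallP => c; rewrite ffunE.
  rewrite mulr1; congr (_%:R); congr nat_of_bool; apply/forall_inP/forallP => h.
    by move=> c; rewrite ffunE h // (valP c).
  by move=> i iC; have := h (Sub i iC); rewrite ffunE SubK.
rewrite (_ : replies a z = false) ?mulr0 //; apply: contraNF aa0 => /forallP h.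
by apply/eqP/ffunP => c; rewrite ffunE (eqP (h c)).
Qed.

Lemma accepted_upd a z i x : i \notin C -> accepted a (upd z i x) = accepted a z.
Proof.
move=> iC; apply: eq_forallb => c; rewrite upd_other //.
by apply: contraNneq iC => <-; exact: valP.
Qed.

Definition freeze (r : {ffun 'I_n -> S}) : Z := [ffun j => (r j).2].

Definition reply_mass a (r : {ffun 'I_n -> S}) : R :=
  expect (cond_dist r) (fun y => (replies a y)%:R).

(** The question at [i] is drawn afresh from [mu], independently of the transcript; [accepted]
    ignores it because [i] is outside [C]. *)
Lemma expect_won_resample i (H : Z -> R) : i \notin C ->
  expect (fun=> gmu G) (fun z => (won C z)%:R * H z) =
  \sum_a expect (fun=> pair_dist) (fun r =>
    (accepted a (freeze r))%:R * \sum_x gmu G x *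
      expect (cond_dist r) (fun y => (replies a (upd y i x))%:R * H (upd y i x))).
Proof.
move=> iC.
rewrite (@eq_expect _ _ _ _ _ (fun z => \sum_a (accepted a z)%:R * ((replies a z)%:R * H z))).
  rewrite expect_sum; apply: eq_bigr => a _.
  rewrite (expect_resample (nu := fun=> gmu G) (i := i)) //.
  rewrite (@eq_expect _ _ _ _ _ (fun z => (accepted a z)%:R *
      \sum_x gmu G x * ((replies a (upd z i x))%:R * H (upd z i x)))).
    rewrite expect_accepted; apply: eq_expect => r; congr (_ * _).
    by rewrite expect_sum; apply: eq_bigr => x _; rewrite expectZ.
  move=> z; rewrite mulr_sumr; apply: eq_bigr => x _.
  by rewrite accepted_upd // mulrCA.
by move=> z; rewrite wonE mulr_suml; apply: eq_bigr => a _; rewrite mulrA.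
Qed.

Lemma win_onE : win_on C = \sum_a expect (fun=> pair_dist) (fun r =>
  (accepted a (freeze r))%:R * reply_mass a r).
Proof.
rewrite /win_on (@eq_expect _ _ _ _ _ (fun z => \sum_a (accepted a z)%:R * (replies a z)%:R)).
  by rewrite expect_sum; apply: eq_bigr => a _; rewrite expect_accepted.
by move=> z; rewrite wonE.
Qed.

Lemma win_on_resample i : i \notin C ->
  win_on C = \sum_a expect (fun=> pair_dist) (fun r =>
    (accepted a (freeze r))%:R * \sum_x gmu G x * cond_mass a r i x).
Proof.
move=> iC; have := expect_won_resample (fun=> 1) iC.
rewrite (@eq_expect _ _ _ _ _ (fun z => (won C z)%:R)) => [|z]; last by rewrite mulr1.
rewrite -/(win_on C) => ->; apply: eq_bigr => a _; apply: eq_expect => r; congr (_ * _).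
apply: eq_bigr => x _; congr (_ * _).
by apply: eq_expect => y; rewrite mulr1.
Qed.

Lemma win_on_next i : i \notin C ->
  win_on (i |: C) = \sum_a expect (fun=> pair_dist) (fun r =>
    (accepted a (freeze r))%:R * \sum_x gmu G x *
      expect (cond_dist r) (fun y =>
        (replies a (upd y i x))%:R * (gV G x (resp (upd y i x) i))%:R)).
Proof.
move=> iC; have := expect_won_resample (fun z => (gV G (z i) (resp z i))%:R) iC.
rewrite (@eq_expect _ _ _ _ _ (fun z => (won (i |: C) z)%:R)) => [|z].
  rewrite -/(win_on (i |: C)) => ->; apply: eq_bigr => a _; apply: eq_expect => r; congr (_ * _).
  apply: eq_bigr => x _; congr (_ * _).
  by apply: eq_expect => y; rewrite upd_same.
rewrite -natrM mulnb; congr (_%:R); congr nat_of_bool.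
apply/andP/forall_inP => [[/forall_inP wC wi] j|h].
  by rewrite !inE => /orP[/eqP->|/wC].
split; last by apply: h; rewrite setU11.
by apply/forall_inP => j jC; apply: h; rewrite setU1r.
Qed.

Lemma cond_mass_ge0 a r i x : 0 <= cond_mass a r i x.
Proof. by apply: expect_ge0 => [j z|y]; rewrite ?frozen_kern_ge0 ?ler0n. Qed.

Variable lam : R.
Hypothesis poincare : forall g : qtuple Q -> R, (forall x, 0 <= g x) ->
  lam * var_sqrt (gmu G) g <= \sum_s pair_dist s * var_sqrt (kern (gmu G) s.1 s.2) g.

Lemma cond_mass_upd a r i s : cond_mass a (upd r i s) i =1 cond_mass a r i.
Proof.
move=> x; apply: (@expect_indep _ _ _ _ _ i) => [j ji y|||y x'].
- by rewrite upd_other.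
- exact: frozen_kern_sum.
- exact: frozen_kern_sum.
- by rewrite upd_upd.
Qed.

Lemma freeze_upd r i s : freeze (upd r i s) = upd (freeze r) i s.2.
Proof. by apply/ffunP => j; rewrite !ffunE; case: eqP. Qed.

Lemma eq_var_sqrt (nu g g' : qtuple Q -> R) : g =1 g' -> var_sqrt nu g = var_sqrt nu g'.
Proof.
by move=> gg; rewrite /var_sqrt; congr (_ - _ ^+ 2); apply: eq_bigr => x _; rewrite gg.
Qed.

(** Neither [accepted] nor [cond_mass] depends on the player and question revealed at [i]; averaging
    over them gives the right side of [poincare]. *)
Lemma expect_var_le a i : i \notin C ->
  lam * expect (fun=> pair_dist) (fun r =>
    (accepted a (freeze r))%:R * var_sqrt (gmu G) (cond_mass a r i)) <=
  expect (fun=> pair_dist) (fun r =>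
    (accepted a (freeze r))%:R * var_sqrt (frozen_kern i (r i)) (cond_mass a r i)).
Proof.
move=> iC.
rewrite [leRHS](expect_resample (nu := fun=> pair_dist) (i := i)) //; last exact: pair_dist_sum.
rewrite -expectZ; apply: ler_expect => [_ s|r]; first exact: pair_dist_ge0.
rewrite mulrCA; apply: le_trans (_ : (accepted a (freeze r))%:R *
    (\sum_s pair_dist s * var_sqrt (kern (gmu G) s.1 s.2) (cond_mass a r i)) <= _).
  by rewrite ler_wpM2l ?ler0n // poincare // => x; exact: cond_mass_ge0.
rewrite mulr_sumr; apply: ler_sum => s _; rewrite mulrCA.
rewrite freeze_upd accepted_upd // upd_same (eq_var_sqrt _ (cond_mass_upd a r i s)).
by rewrite /frozen_kern (negPf iC).
Qed.

(** For each [r], superadditivity is applied to the product measure given [r] and the indicator of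
    [replies a]. *)
Lemma sum_var_le a :
  lam * (\sum_(i | i \notin C) expect (fun=> pair_dist) (fun r =>
    (accepted a (freeze r))%:R * var_sqrt (gmu G) (cond_mass a r i))) <=
  expect (fun=> pair_dist) (fun r =>
    (accepted a (freeze r))%:R * - (reply_mass a r * ln (reply_mass a r))).
Proof.
rewrite mulr_sumr.
apply: le_trans (ler_sum _ (fun i iC => expect_var_le a iC)) _.
rewrite -expect_sum; apply: ler_expect => [_ s|r]; first exact: pair_dist_ge0.
rewrite -mulr_sumr ler_wpM2l ?ler0n //.
apply: le_trans (@sum_var_sqrt_le R _ _ (cond_dist r) _ _ (fun y => (replies a y)%:R) _
  (fun i => i \notin C)).
- apply: ler_sum => i _; rewrite /var_sqrt.
  have -> // : \sum_x frozen_kern i (r i) x * cond_mass a r i x = reply_mass a r.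
  exact: (@cond_mean_average R _ _ (cond_dist r) (fun j => frozen_kern_sum j (r j))
    (fun y => (replies a y)%:R) i).
- by move=> j x; exact: frozen_kern_ge0.
- by move=> j; exact: frozen_kern_sum.
- by move=> y; rewrite ler0n lern1 leq_b1.
Qed.

Lemma entropy_transcript : 0 < win_on C ->
  \sum_a expect (fun=> pair_dist) (fun r =>
    (accepted a (freeze r))%:R * - (reply_mass a r * ln (reply_mass a r))) <=
  win_on C * ln (#|qtuple A|%:R ^+ #|C| / win_on C).
Proof.
move=> p0; set p := win_on C in p0 *.
have -> : #|qtuple A|%:R ^+ #|C| = #|{: trans}|%:R :> R.
  by rewrite card_ffun card_sig natrX.
set N := #|{: trans}|%:R.
have N0 : 0 < N :> R.
  rewrite ltr0n lt0n; apply/negP => /eqP N0; move: p0.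
  by rewrite /p win_onE big1 ?ltxx // => a; have := fintype0 a N0.
have b0 : 0 < p / N by rewrite divr_gt0.
(* The tangent is taken at [p / N], the average over [a] and [r] of the accepted mass. *)
apply: le_trans (_ : \sum_a expect (fun=> pair_dist) (fun r =>
   (- ln (p / N) - 1) * ((accepted a (freeze r))%:R * reply_mass a r) + p / N * 1) <= _).
  apply: ler_sum => a _; apply: ler_expect => [_ s|r]; first exact: pair_dist_ge0.
  have m0 : 0 <= reply_mass a r.
    by apply: expect_ge0 => [j z|y]; rewrite ?frozen_kern_ge0 ?ler0n.
  case: (accepted a _); last by rewrite !mul0r mulr0 add0r mulr1 ltW.
  rewrite !mul1r mulr1.
  have := xlnx_tangent m0 b0; lra.
under eq_bigr do rewrite expectD !expectZ (expect1 (fun=> pair_dist_sum)) mulr1.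
rewrite big_split /= -mulr_sumr -win_onE -/p sumr_const -[_ *+ _]mulr_natl -/N.
rewrite mulrCA divff ?gt_eqF // mulr1 !ln_div ?posrE //; lra.
Qed.

Lemma sum_win_on_next eps : 0 < lam -> 0 <= eps -> game_val G <= 1 - eps -> 0 < win_on C ->
  \sum_(i | i \notin C) win_on (i |: C) <=
  (1 - eps / 2) * win_on C *+ #|~: C| +
  2 * (win_on C * ln (#|qtuple A|%:R ^+ #|C| / win_on C)) / lam.
Proof.
move=> lam0 eps0 valG p0.
pose E i a := expect (fun=> pair_dist) (fun r =>
    (accepted a (freeze r))%:R * var_sqrt (gmu G) (cond_mass a r i)).
apply: le_trans (_ : \sum_(i | i \notin C) ((1 - eps / 2) * win_on C + 2 * \sum_a E i a) <= _).
  apply: ler_sum => i iC; rewrite win_on_next // (win_on_resample iC) !mulr_sumr -big_split /=.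
  apply: ler_sum => a _; rewrite -!expectZ -expectD.
  apply: ler_expect => [_ s|r]; first exact: pair_dist_ge0.
  rewrite mulrCA [X in _ + X]mulrCA -mulrDr ler_wpM2l ?ler0n //.
  exact: cond_one_shot.
rewrite big_split /= sumr_const cardsE /=; apply: lerD.
  by rewrite (eq_card (B := [predC C])) //= => i; rewrite !inE.
rewrite -mulr_sumr -mulrA ler_wpM2l // ler_pdivlMr // [_ * lam]mulrC.
apply: le_trans (entropy_transcript p0).
rewrite exchange_big mulr_sumr /=; apply: ler_sum => a _; exact: sum_var_le.
Qed.

End Step.
End Repetition.

(** * Iteration *)

Section Iteration.
Variables (R : realType) (k : nat) (Q A : 'I_k -> finType) (G : game R Q A).
Variables (n : nat) (f : strategy (rep_fam n Q) (rep_fam n A)).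
Variables eps lam : R.
Hypotheses (muD : is_distr (gmu G)) (eps01 : 0 < eps < 1) (lam01 : 0 < lam < 1).
Hypotheses (valG : game_val G <= 1 - eps) (expG : is_expander (gmu G) lam).

Let p C := win_on G f C.

(** Otherwise the sum over the [M] coordinates outside [C] exceeds its bound: the gap is
    [p C * M * eps / 4], while the entropy term is at most [p C * M * eps / 8], using [n <= 2 M]. *)
Lemma exists_next (C : {set 'I_n}) : (0 < n)%N -> (2 * #|C| <= n)%N -> 0 < p C ->
  ln (#|qtuple A|%:R ^+ #|C| / p C) <= n%:R * eps * lam / 32 ->
  exists2 i, i \notin C & p (i |: C) <= (1 - eps / 4) * p C.
Proof.
have [eps0 eps1] := andP eps01; have [lam0 lam1] := andP lam01.
move=> n0 Cn p0 hD.
apply/exists_inP; apply: contraT; rewrite negb_exists_in => /forall_inP h.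
have poincare (g : qtuple Q -> R) : (forall x, 0 <= g x) ->
    lam * var_sqrt (gmu G) g <=
    \sum_s pair_dist G s * var_sqrt (kern (gmu G) s.1 s.2) g.
  move=> g0; have := glauber_poincare muD (expander_players lam0 expG)
    (fun x => Num.sqrt (g x)) lam0 expG.
  have gE (nu : qtuple Q -> R) :
      \sum_x nu x * Num.sqrt (g x) ^+ 2 = \sum_x nu x * g x.
    by apply: eq_bigr => x _; rewrite sqr_sqrtr.
  rewrite (gE (gmu G)) => /le_trans; apply; apply: ler_sum => s _.
  by rewrite (gE (kern (gmu G) s.1 s.2)).
have := sum_win_on_next muD (expander_players lam0 expG) poincare lam0 (ltW eps0) valG p0.
rewrite -/(p C); set D := ln _ in hD *; set M := #|~: C|.
have ME : M%:R = n%:R - #|C|%:R :> R.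
  by rewrite /M cardsCs setCK card_ord natrB // (leq_trans _ Cn) // leq_pmull.
have M2 : n%:R <= 2 * M%:R :> R.
  rewrite ME; have : (2 * #|C|)%:R <= n%:R :> R by rewrite ler_nat.
  by rewrite natrM; lra.
have n0' : 0 < n%:R :> R by rewrite ltr0n.
have M0 : 0 < M%:R :> R by lra.
have lower : ((1 - eps / 4) * p C) * M%:R <= \sum_(i | i \notin C) p (i |: C).
  have -> : ((1 - eps / 4) * p C) * M%:R = \sum_(i | i \notin C) (1 - eps / 4) * p C.
    rewrite sumr_const mulr_natr; congr (_ *+ _).
    by apply: eq_card => i; rewrite !inE.
  by apply: ler_sum => i /h; rewrite -ltNge => /ltW.
move=> upper; have := le_trans lower upper.
have Dl : 2 * (p C * D) / lam <= p C * (n%:R * eps / 16).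
  rewrite ler_pdivrMr //; have := ler_wpM2l (ltW p0) hD; lra.
rewrite -[_ *+ M]mulr_natr.
have : p C * (n%:R * eps / 16) <= p C * (2 * M%:R * eps / 16).
  apply: ler_wpM2l; first exact: ltW.
  by have := ler_wpM2r (ltW eps0) M2; lra.
have : 0 < p C * (M%:R * eps) by rewrite !mulr_gt0.
lra.
Qed.

(** As [T] bounds [ln (1 / p C)] for all [C] at once, the entropy budget depends only on the number
    of steps. *)
Lemma win_on_iterate T m : (0 < n)%N -> (0 < #|qtuple A|)%N ->
  (forall C, expR (- T) < p C) ->
  (forall j, (j < m)%N -> (2 * j <= n)%N /\
     j%:R * ln #|qtuple A|%:R + T <= n%:R * eps * lam / 32) ->
  exists C : {set 'I_n}, #|C| = m /\ p C <= (1 - eps / 4) ^+ m.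
Proof.
have [eps0 eps1] := andP eps01.
move=> n0 A0 pT; elim: m => [_|m IH hm].
  by exists set0; rewrite cards0 expr0 /p (win_on0 _ muD) lexx.
have [C [CE pC]] := IH (fun j jm => hm j (ltnW jm)).
have [m2 mD] := hm m (ltnSn m).
have p0 : 0 < p C by apply: lt_trans (pT C); exact: expR_gt0.
have [||i iC pi] := @exists_next C n0 _ p0; rewrite ?CE //.
  have A0' : 0 < #|qtuple A|%:R :> R by rewrite ltr0n.
  apply: le_trans mD; rewrite ln_div ?posrE ?exprn_gt0 // lnXn // -[_ *+ m]mulr_natl lerD2l.
  by rewrite lerNl -ler_expR lnK ?posrE // ltW.
exists (i |: C); rewrite cardsU1 iC CE add1n; split=> //.
apply: le_trans pi _; rewrite exprS ler_wpM2l //; lra.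
Qed.

Lemma ln2_ge_half : 1 / 2 <= ln (2 : R).
Proof.
have h : 0 < (2 : R)^-1 by rewrite invr_gt0.
by have := ln_le_subr1 h; rewrite lnV ?posrE //; lra.
Qed.

(** If the bound fails, then by monotonicity [p C > exp (- T)] for every [C], so the iteration runs
    long enough to push some [p C] down to [exp (- T)]. *)
Lemma win_on_all :
  p setT <= expR (- (256^-1 * eps ^+ 5 * lam ^+ 2 * n%:R) / ln #|qtuple A|%:R).
Proof.
have [eps0 eps1] := andP eps01; have [lam0 lam1] := andP lam01.
have le1 : p setT <= 1.
  by rewrite -[leRHS](@win_on0 R k Q A G n f muD); apply: win_on_subset => //; exact: sub0set.
(* Here [ln] is 0 and division by 0 gives 0, so the claimed bound is 1. *)
have [A1|A2] := leqP #|qtuple A| 1.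
  have -> : ln #|qtuple A|%:R = 0 :> R.
    by case: #|_| A1 => [|[|m]] // _; [exact: ln0 | exact: ln1].
  by rewrite invr0 mulr0 exp.expR0.
have [n0|n0] := posnP n.
  have -> : n%:R = 0 :> R by rewrite n0.
  by rewrite mulr0 oppr0 mul0r exp.expR0.
set N := #|qtuple A|%:R; set L := ln N.
have L2 : 1 / 2 <= L.
  apply: le_trans ln2_ge_half _; rewrite ler_ln ?posrE ?ltr0n ?(ltnW A2) //.
  by rewrite ler_nat.
have L0 : 0 < L by lra.
rewrite leNgt; apply/negP => pT.
rewrite mulNr in pT; set T := (_ / L) in pT.
have e5 : eps ^+ 5 * lam ^+ 2 <= eps ^+ 2 * lam.
  apply: ler_pM; rewrite ?exprn_ge0 ?(ltW eps0) ?(ltW lam0) //.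
    by rewrite (exprD _ 2 3) ler_piMr ?exprn_ge0 ?exprn_ile1 // ltW.
  by rewrite expr2 ler_piMr // ltW.
have e2 : eps ^+ 2 * lam <= eps * lam.
  by rewrite ler_wpM2r ?(ltW lam0) // expr2 ler_piMr // ltW.
have nn : 0 <= n%:R :> R by rewrite ler0n.
have nel0 : 0 <= n%:R * (eps * lam) by rewrite !mulr_ge0 // ltW.
(* The budget [n eps lam / 32] is halved: [x * L] pays for the answers and the other half for
   [T]. *)
pose x := n%:R * (eps * lam) / (64 * L).
have x0 : 0 <= x by rewrite divr_ge0 ?mulr_ge0 // ltW.
have xL : x * L = n%:R * (eps * lam) / 64 by rewrite /x; field; rewrite gt_eqF.
have TL : T * L = 256^-1 * (n%:R * (eps ^+ 5 * lam ^+ 2)).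
  by rewrite /T; field; rewrite gt_eqF.
have Tn : T <= n%:R * (eps * lam) / 64.
  have h1 : T * L <= n%:R * (eps * lam) / 64 * L.
    rewrite TL; apply: le_trans (_ : 256^-1 * (n%:R * (eps * lam)) <= _).
      by rewrite ler_wpM2l ?invr_ge0 // ler_wpM2l // (le_trans e5).
    have : n%:R * (eps * lam) * (1 / 2) <= n%:R * (eps * lam) * L.
      by rewrite ler_wpM2l.
    lra.
  by move: h1; rewrite ler_pM2r.
(* The constant 256 is the product of this 4 and the 64 in [x]. *)
have Tx : T <= eps / 4 * x.
  have h1 : T * L <= eps / 4 * x * L.
    rewrite TL -mulrA xL.
    have : n%:R * (eps ^+ 5 * lam ^+ 2) <= n%:R * (eps ^+ 2 * lam) by rewrite ler_wpM2l.
    rewrite expr2; lra.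
  by move: h1; rewrite ler_pM2r.
(* One step more than the integer part makes the number of steps exceed [x], while every earlier [j]
   is still at most [x]. *)
have [|j jm|C [_ pC]] := @win_on_iterate T (Num.truncn x).+1 n0 (ltnW A2).
- by move=> C; apply: lt_le_trans pT _; apply: win_on_subset => //; exact: subsetT.
- have jx : j%:R <= x.
    by apply: le_trans (_ : (Num.truncn x)%:R <= x); rewrite ?ler_nat ?truncn_le.
  split.
    rewrite -(ler_nat R) natrM.
    have : x * (1 / 2) <= x * L by rewrite ler_wpM2l.
    have : n%:R * (eps * lam) <= n%:R.
      by rewrite ler_piMr // mulr_ile1 // ltW.
    rewrite xL; lra.
  have : j%:R * L <= x * L by rewrite ler_wpM2r // ltW.
  rewrite xL -/N -/L; lra.
have e4 : 1 - eps / 4 <= expR (- (eps / 4)) by exact: expR_ge1Dx.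
have : expR (- T) < expR (- T).
  apply: lt_le_trans (lt_le_trans pT (win_on_subset _ muD (subsetT C))) _.
  apply: le_trans pC _.
  apply: le_trans (_ : expR (- (eps / 4)) ^+ (Num.truncn x).+1 <= _).
    apply: lerXn2r => //; rewrite nnegrE ?expR_ge0 //; lra.
  rewrite -expRM_natl ler_expR mulrN lerN2.
  apply: le_trans Tx _; rewrite mulrC ler_wpM2r //; first lra.
  exact/ltW/truncnS_gt.
by rewrite ltxx.
Qed.

End Iteration.

Theorem theorem2 :
  exists c : Rdefinitions.R, 0 < c /\
  forall (k : nat) (Q A : 'I_k -> finType) (G : game Rdefinitions.R Q A)
         (eps lam : Rdefinitions.R),
    0 < eps < 1 -> 0 < lam < 1 ->
    is_distr (gmu G) ->
    game_val G <= 1 - eps ->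
    is_expander (gmu G) lam ->
    forall n : nat,
      ln (4 / eps) / (eps ^+ 5 * lam ^+ 2) <= n%:R ->
      game_val (rep_game G n) <=
        expR (- (c * eps ^+ 5 * lam ^+ 2 * n%:R) / ln (#|qtuple A|%:R)).
Proof.
exists 256^-1; split=> [|k Q A G eps lam eps01 lam01 muD valG expG n _].
  by rewrite invr_gt0.
(* The maximum over strategies starts from 0, so the bound must also be nonnegative. *)
apply: bigmax_le => [|f _]; first exact: expR_ge0.
by rewrite win_prob_rep; exact: win_on_all.
Qed.
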